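(* Let $n\ge2$, let $\lambda>0$ be real and let $M\ge1$ be an integer. If $f:\mathbb{R}^{n-1}\to\mathbb{R}$ is measurable and $$\int_{\mathbb{R}^{n-1}}|f(y')|\left(|y'|^{M-1}+1\right)dy'<\infty, \qquad ( * )$$ then $$\tilde F_{\lambda,M}[f](x)=o\left(|x|^{-(M+2\lambda-1)}\sec^{2\lambda}\theta\right)\qquad(x\in\Pi_+,\ |x|\to\infty).$$ Moreover this estimate is sharp: for every function $\psi:\Pi_+\to(0,\infty)$ with $\psi(x)=o(|x|^{-(M+2\lambda-1)}\sec^{2\lambda}\theta)$ ($x\in\Pi_+$, $|x|\to\infty$) and every sequence $\{x^{(i)}\}$ in $\Pi_+$ with $|x^{(i)}|\to\infty$, there exists a continuous function $f:\mathbb{R}^{n-1}\to\mathbb{R}$ satisfying $( * )$ such that $\tilde F_{\lambda,M}[f](x^{(i)})/\psi(x^{(i)})\not\to0$ as $i\to\infty$.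
   Context: Half space: $\Pi_+=\{x\in\mathbb{R}^n: x_n>0\}$. For $x\in\Pi_+$ let $y\in\mathbb{R}^{n-1}$ be the projection of $x$ onto $\partial\Pi_+$ (identified with $\mathbb{R}^{n-1}$), and let $\theta\in[0,\pi/2)$ be the angle between $x$ and the unit normal $\hat e_n$, so $x_n=|x|\cos\theta$, $|y|=|x|\sin\theta$. For $y'\in\mathbb{R}^{n-1}$, $\theta'\in[0,\pi]$ is the angle between $y$ and $y'$, so $y\cdot y'=|y'||x|\sin\theta\cos\theta'$ (with $\theta'=\pi/2$ if $y=0$ or $y'=0$; when $n=2$, $\cos\theta'=\operatorname{sgn}(x_1y')$). Put $\Theta=\sin\theta\cos\theta'$. Kernels: $K(\lambda,x,y')=\left[|y'-y|^2+x_n^2\right]^{-\lambda}$, and for $|x|>0$, $M\ge1$, $$\tilde K_M(\lambda,x,y')=K(\lambda,x,y')-\sum_{m=0}^{M-1}\frac{|y'|^m}{|x|^{m+2\lambda}}C_m^\lambda(\Theta),$$ where $C_m^\lambda$ are the Gegenbauer polynomials, defined by $(1-2tz+z^2)^{-\lambda}=\sum_{m\ge0}z^mC_m^\lambda(t)$. Define $$\tilde F_{\lambda,M}[f](x)=\int_{\mathbb{R}^{n-1}}f(y')\tilde K_M(\lambda,x,y')\,dy'.$$ Order relations: $g(x)=o(\omega(x))$ ($x\in\Pi_+$, $|x|\to\infty$) means $\sup\{|g(x)|/\omega(x):x\in\Pi_+,|x|=r\}\to0$ as $r\to\infty$. *)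

(* Defs.v *)
From HB Require Import structures.
From mathcomp Require Import all_boot all_order all_algebra.
From mathcomp Require Import all_classical all_reals all_analysis.
From mathcomp Require Import ring lra.

Set Implicit Arguments.
Unset Strict Implicit.
Unset Printing Implicit Defensive.
Import Order.TTheory GRing.Theory Num.Theory.
Import numFieldNormedType.Exports.
Local Open Scope classical_set_scope.
Local Open Scope ring_scope.

(* The product sigma-algebra on R^m (row vectors), generated by the
   coordinate functions. *)
Definition rV_display : measure_display -> measure_display.
Proof. exact. Qed.

Section measurable_rV.
Context {R : realType} {m : nat}.

Let coor (i : 'I_m) (v : 'rV[R]_m) : measurableTypeR R := v ord0 i.

Let rV_set0 : g_sigma_preimage coor set0.
Proof. exact: sigma_algebra0. Qed.

Let rV_setC A : g_sigma_preimage coor A -> g_sigma_preimage coor (~` A).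
Proof. exact: sigma_algebraC. Qed.

Let rV_bigcup (F : (set 'rV[R]_m)^nat) :
  (forall i, g_sigma_preimage coor (F i)) ->
  g_sigma_preimage coor (\bigcup_i F i).
Proof. exact: sigma_algebra_bigcup. Qed.

HB.instance Definition _ := @isMeasurable.Build
  (rV_display default_measure_display)
  'rV[R]_m (g_sigma_preimage coor) rV_set0 rV_setC rV_bigcup.

Lemma measurable_coor (i : 'I_m) :
  measurable_fun [set: 'rV[R]_m]
    (fun v : 'rV[R]_m => v ord0 i : measurableTypeR R).
Proof.
move=> _ Y mY; rewrite setTI; apply: sub_sigma_algebra => /=.
rewrite -bigcup_seq/=; exists i => /=; first by rewrite mem_index_enum.
by exists Y => //; rewrite setTI.
Qed.

Lemma measurable_fun_rV d (T : measurableType d) (f : T -> 'rV[R]_m) :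
  (forall i, measurable_fun [set: T] (fun t => f t ord0 i : measurableTypeR R)) ->
  measurable_fun [set: T] f.
Proof.
move=> mf _ Y mY; rewrite setTI.
have : <<s measurable >> (f @^-1` Y); last first.
  by apply: smallest_sub => //; exact: sigma_algebra_measurable.
move: Y mY; rewrite /measurable/=.
suff : g_sigma_preimage coor `<=` [set Y | measurable (f @^-1` Y)].
  by move=> + Y mY => /(_ _ mY) /= ?; exact: sub_sigma_algebra.
apply: smallest_sub.
  split => /=.
  - by rewrite preimage_set0.
  - by move=> A mA; rewrite setTD preimage_setC; exact: measurableC.
  - by move=> F mF; rewrite preimage_bigcup; exact: bigcup_measurable.
rewrite -bigcup_seq => A [i _ [B mB <-]] /=.
by rewrite setTI; have := mf i measurableT B mB; rewrite setTI.
Qed.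

End measurable_rV.

(* Iterated product of lebesgue_measure; lebesgue_rV_box gives volumes of boxes. *)
Section lebesgue_rV.
Context {R : realType}.

Definition rV_cons m (p : measurableTypeR R * 'rV[R]_m) : 'rV[R]_m.+1 :=
  \row_i (if unlift ord0 i is Some j then p.2 ord0 j else p.1).

Definition rV_uncons m (v : 'rV[R]_m.+1) : measurableTypeR R * 'rV[R]_m :=
  (v ord0 ord0, \row_j v ord0 (lift ord0 j)).

Lemma rV_consK m : cancel (@rV_cons m) (@rV_uncons m).
Proof.
move=> [x v]; rewrite /rV_uncons /rV_cons mxE unlift_none /=; congr pair.
by apply/rowP => j; rewrite !mxE liftK.
Qed.

Lemma rV_unconsK m : cancel (@rV_uncons m) (@rV_cons m).
Proof.
move=> v; apply/rowP => j; rewrite mxE /=.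
by case: unliftP => [k|] -> //=; rewrite mxE.
Qed.

Lemma measurable_rV_cons m : measurable_fun setT (@rV_cons m).
Proof.
apply: measurable_fun_rV => i.
rewrite (_ : (fun _ => _) = (fun p : measurableTypeR R * 'rV[R]_m =>
    if unlift ord0 i is Some j then p.2 ord0 j else p.1)); last first.
  by apply/funext => p; rewrite mxE.
case: (unlift ord0 i) => [j|]; last exact: measurable_fst.
apply: (measurableT_comp (measurable_coor j)); exact: measurable_snd.
Qed.

Lemma measurable_rV_uncons m : measurable_fun setT (@rV_uncons m).
Proof.
apply: measurable_fun_pair; first exact: measurable_coor.
apply: measurable_fun_rV => i.
rewrite (_ : (fun _ => _) = (fun v : 'rV[R]_m.+1 =>
  v ord0 (lift ord0 i) : measurableTypeR R)).
  exact: measurable_coor.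
by apply/funext => v; rewrite mxE.
Qed.

HB.instance Definition _ m :=
  isMeasurableFun.Build _ _ _ _ (@rV_cons m) (@measurable_rV_cons m).

Section lebesgue_rV_step.
Context {m : nat}.
Variable mu : {sigma_finite_measure set 'rV[R]_m -> \bar R}.
Local Open Scope ereal_scope.

Definition lebesgue_rV_step : set 'rV[R]_m.+1 -> \bar R :=
  pushforward (@lebesgue_measure R \x mu) (@rV_cons m).

Let step0 : lebesgue_rV_step set0 = 0.
Proof. exact: measure0. Qed.

Let step_ge0 A : 0 <= lebesgue_rV_step A.
Proof. exact: measure_ge0. Qed.

Let step_sigma_additive : semi_sigma_additive lebesgue_rV_step.
Proof. exact: measure_semi_sigma_additive. Qed.

HB.instance Definition _ := isMeasure.Build _ _ _ lebesgue_rV_step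
  step0 step_ge0 step_sigma_additive.

Let step_sigma_finite : sigma_finite setT lebesgue_rV_step.
Proof.
have /sigma_finiteP[F [FT ndF mF]] := sigma_finiteT (@lebesgue_measure R).
have /sigma_finiteP[G [GT ndG mG]] := sigma_finiteT mu.
exists (fun k => @rV_uncons m @^-1` (F k `*` G k)).
  rewrite -preimage_bigcup (_ : \bigcup_k _ = setT) ?preimage_setT//.
  rewrite -setXTT FT GT predeqE => -[x v]; split.
    by move=> [n _ []/= ? ?]; split; exists n.
  move=> [/= [n _ Fnx] [k _ Gkv]]; exists (maxn n k) => //; split.
  - by move: x Fnx; exact/subsetPset/ndF/leq_maxl.
  - by move: v Gkv; exact/subsetPset/ndG/leq_maxr.
move=> k; have [mFk Fk] := mF k; have [mGk Gk] := mG k; split.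
  rewrite -[X in measurable X]setTI; apply: measurable_rV_uncons => //.
  exact: measurableX.
rewrite /lebesgue_rV_step /pushforward -comp_preimage.
rewrite (_ : _ \o _ = id); last by apply/funext/rV_consK.
by rewrite preimage_id product_measure1E// lte_mul_pinfty// ge0_fin_numE.
Qed.

HB.instance Definition _ := Measure_isSigmaFinite.Build _ _ _ lebesgue_rV_step
  step_sigma_finite.

End lebesgue_rV_step.

Fixpoint lebesgue_rV m : {sigma_finite_measure set 'rV[R]_m -> \bar R} :=
  if m is m'.+1 then lebesgue_rV_step (lebesgue_rV m')
  else \d_(0 : 'rV[R]_0).

Lemma lebesgue_rV_box m (A : 'I_m -> set (measurableTypeR R)) :
  (forall i, measurable (A i)) ->
  lebesgue_rV m [set v | forall i, A i (v ord0 i)] =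
    (\prod_(i < m) lebesgue_measure (A i))%E.
Proof.
elim: m A => [|m IH] A mA.
  by rewrite big_ord0 /= diracE mem_set// => -[].
rewrite big_ord_recl /= /lebesgue_rV_step /pushforward.
pose B := [set v : 'rV[R]_m | forall i, A (lift ord0 i) (v ord0 i)].
have mB : measurable B.
  rewrite (_ : B = \big[setI/setT]_(i < m)
      ((fun v : 'rV[R]_m => v ord0 i : measurableTypeR R) @^-1` A (lift ord0 i))).
    apply: bigsetI_measurable => i _.
    by rewrite -[X in measurable X]setTI; exact: measurable_coor.
  rewrite -bigcap_seq; apply/seteqP; split => [v Bv i _|v Bv i]; first exact: Bv.
  by apply: (Bv i); rewrite /= mem_index_enum.
rewrite (_ : _ @^-1` _ = A ord0 `*` B).
  by rewrite product_measure1E//; congr (_ * _)%E; exact: IH.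
apply/seteqP; split => [[x v] /= Av|[x v] /= [Ax Bv] i].
  split; first by have := Av ord0; rewrite mxE unlift_none.
  by move=> i; have := Av (lift ord0 i); rewrite mxE liftK.
by rewrite mxE /=; case: unliftP => [j|] ->.
Qed.

End lebesgue_rV.

(* Lebesgue measure on R^m, on the completed (Caratheodory) sigma-algebra. *)
Section completed_lebesgue_rV.
Context {R : realType} (m : nat).

Definition lebesgue_rV_type := caratheodory_type ((@lebesgue_rV R m)^*)%mu.

HB.instance Definition _ := Measurable.on lebesgue_rV_type.

Definition completed_lebesgue_rV : set lebesgue_rV_type -> \bar R :=
  @completed_measure_extension _ _ _ (@lebesgue_rV R m).

HB.instance Definition _ := Measure.on completed_lebesgue_rV.

Definition lebesgue_measurable_fun (f : 'rV[R]_m -> R) :=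
  measurable_fun [set: lebesgue_rV_type]
    (f : lebesgue_rV_type -> measurableTypeR R).

End completed_lebesgue_rV.

Section euclidean.
Context {R : realType}.

Definition dotp m (u v : 'rV[R]_m) : R := \sum_i u ord0 i * v ord0 i.

(* The library norm on row vectors is the sup norm. *)
Definition enorm m (v : 'rV[R]_m) : R := Num.sqrt (dotp v v).

Definition angle m (u v : 'rV[R]_m) : R :=
  if (u == 0) || (v == 0) then pi / 2 else acos (dotp u v / (enorm u * enorm v)).

End euclidean.

(* Points of R^n are row vectors with n = m.+1 coordinates; the last one is the
   height above the boundary R^m. *)
Section half_space.
Context {R : realType} {m : nat}.
Implicit Types (x : 'rV[R]_m.+1) (y : 'rV[R]_m).

Definition height x : R := x ord0 ord_max.

Definition half_space : set 'rV[R]_m.+1 := [set x | 0 < height x].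

Definition bproj x : 'rV[R]_m := \row_j x ord0 (widen_ord (leqnSn m) j).

Definition theta x : R := acos (height x / enorm x).

Definition theta' x y' : R := angle (bproj x) y'.

Definition Theta x y' : R := sin (theta x) * cos (theta' x y').

Definition sec (a : R) : R := (cos a)^-1.

Definition little_o (g w : 'rV[R]_m.+1 -> R) :=
  ereal_sup [set (`|g x| / w x)%:E | x in [set x | half_space x /\ enorm x = r]]
    @[r --> +oo] --> 0%:E.

End half_space.

Section gegenbauer.
Context {R : realType}.

(* The generating identity is an identity of real power series in z, required
   for z in a neighbourhood of 0 that may depend on t; since the sum of a power
   series near 0 determines its coefficients, at most one family C of
   polynomials satisfies it. *)
Definition is_gegenbauer (lambda : R) (C : nat -> {poly R}) :=
  forall t : R, \forall z \near (0 : R),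
    pseries (fun k => (C k).[t]) z @ \oo -->
    (1 - 2 * t * z + z ^+ 2) `^ (- lambda).

Definition gegenbauer (lambda : R) : nat -> {poly R} :=
  xget (fun=> 0) (is_gegenbauer lambda).

End gegenbauer.

Section gegenbauer_exists.
Context {R : realType}.
Variable lambda : R.
Hypothesis l0 : 0 < lambda.

Fixpoint gpair (k : nat) : {poly R} * {poly R} :=
  if k is k'.+1 then
    let p := gpair k' in
    (p.2, (k'.+2%:R^-1)%:P * ((2 * (k'.+1%:R + lambda)) *: ('X * p.2)
              - (k'%:R + 2 * lambda) *: p.1))
  else (1, (2 * lambda) *: 'X).
Definition gpoly k := (gpair k).1.

Lemma pseries_dominated (a : nat -> R) (c D z : R) :
  (forall k, `|a k| <= c * D ^+ k) -> 0 <= D -> D * `|z| < 1 ->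
  cvgn (pseries a z).
Proof.
move=> aD D0 Dz; rewrite /pseries; apply: normed_cvg.
apply: (@series_le_cvg _ _ (geometric c (D * `|z|))).
- by move=> k; exact: normr_ge0.
- move=> k; apply: mulr_ge0; last by rewrite exprn_ge0// mulr_ge0.
  by have := aD 0; rewrite expr0 mulr1; apply: le_trans.
- move=> k; rewrite /= normrM normrX exprMn mulrA; exact: ler_wpM2r.
- by apply: is_cvg_geometric_series; rewrite ger0_norm ?mulr_ge0.
Qed.

Lemma diffs_dominated (a : nat -> R) (c D : R) :
  (forall k, `|a k| <= c * D ^+ k) -> 0 <= D ->
  forall k, `|pseries_diffs a k| <= (c * D) * (2 * D) ^+ k.
Proof.
move=> aD D0 k; rewrite /pseries_diffs normrM ger0_norm//.
have c0 : 0 <= c by have := aD 0; rewrite expr0 mulr1; apply: le_trans.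
apply: (@le_trans _ _ (2 ^+ k * (c * D ^+ k.+1))); last first.
  by rewrite exprMn exprS le_eqVlt; apply/orP; left; apply/eqP; ring.
apply: ler_pM => //; rewrite -natrX ler_nat; exact: ltn_expl.
Qed.

Lemma gpolyE k : gpoly k.+2 =
  (k.+2%:R^-1)%:P * ((2 * (k.+1%:R + lambda)) *: ('X * gpoly k.+1)
              - (k%:R + 2 * lambda) *: gpoly k).
Proof. by []. Qed.

Lemma gpoly_rec t k : k.+2%:R * (gpoly k.+2).[t] =
    2 * (k.+1%:R + lambda) * t * (gpoly k.+1).[t] -
    (k%:R + 2 * lambda) * (gpoly k).[t].
Proof.
  rewrite gpolyE hornerM hornerC hornerD hornerN !hornerZ hornerM hornerX.
  have : k.+2%:R != 0 :> R by rewrite pnatr_eq0.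
  by move: (k.+2%:R) => u u0; field.
Qed.

Lemma gegaux (l u j : R) : 0 <= l -> 0 <= u -> 0 <= j ->
  [/\ 1 <= 2 * (1 + l) * u + (1 + 2 * l),
      2 * l * u <= 2 * (1 + l) * u + (1 + 2 * l) &
      2 * (j + 1 + l) * u + (j + 2 * l) <=
        (j + 2) * (2 * (1 + l) * u + (1 + 2 * l))].
Proof.
move=> l0' u0 j0; have lu := mulr_ge0 l0' u0; have lj := mulr_ge0 l0' j0.
have uj := mulr_ge0 u0 j0; have luj := mulr_ge0 lu j0.
by split; nra.
Qed.

Lemma gpoly_bound (t : R) :
  exists2 D : R, 1 <= D & forall k, `|(gpoly k).[t]| <= D ^+ k.
Proof.
set a := fun k => (gpoly k).[t].
have aE k := gpoly_rec t k; rewrite -/(a _) -/(a _) -/(a _) in aE.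
set D := 2 * (1 + lambda) * `|t| + (1 + 2 * lambda).
have D1 : 1 <= D.
  by have [] := gegaux (ltW l0) (normr_ge0 t) (lexx 0).
have D0 : 0 <= D by exact: le_trans D1.
exists D => // k; suff [] : `|a k| <= D ^+ k /\ `|a k.+1| <= D ^+ k.+1 by [].
elim: k => [|k [IH0 IH1]].
  rewrite /a /gpoly /= hornerC hornerZ hornerX expr0 normr1 expr1 lexx; split => //.
  rewrite !normrM (ger0_norm (ltW l0)) ger0_norm//.
  by have [] := gegaux (ltW l0) (normr_ge0 t) (lexx 0).
split => //.
have k2 : 0 < k.+2%:R :> R by rewrite ltr0n.
rewrite -(ler_pM2l k2) -[X in X * `|_|](ger0_norm (ltW k2)) -normrM aE.
apply: (le_trans (ler_normB _ _)).
have A1 : 0 <= 2 * (k.+1%:R + lambda) by rewrite mulr_ge0// addr_ge0// ltW.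
have A2 : 0 <= k%:R + 2 * lambda by rewrite addr_ge0// mulr_ge0// ltW.
rewrite 2![`|_ * a _|]normrM (normrM _ t) (ger0_norm A1) (ger0_norm A2).
have Dk : D ^+ k <= D ^+ k.+1 by rewrite exprS ler_peMl// exprn_ge0.
have kE : k.+2%:R = k%:R + 2 :> R by rewrite -addn2 natrD.
have kE1 : k.+1%:R = k%:R + 1 :> R by rewrite -addn1 natrD.
apply: (@le_trans _ _ (2 * (k.+1%:R + lambda) * `|t| * D ^+ k.+1 +
   (k%:R + 2 * lambda) * D ^+ k.+1)).
  apply: lerD; first by apply: ler_wpM2l => //; rewrite mulr_ge0.
  apply: ler_pM => //.
  exact: le_trans IH0 Dk.
rewrite -mulrDl (exprS _ k.+1) mulrA; apply: ler_wpM2r; first exact: exprn_ge0.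
rewrite kE kE1; by have [] := gegaux (ltW l0) (normr_ge0 t) (ler0n R k).
Qed.

Lemma gpoly_ode (t z : R) (a := fun k => (gpoly k).[t]) :
  cvgn (pseries a z) -> cvgn (pseries (pseries_diffs a) z) ->
  (1 - 2 * t * z + z ^+ 2) * limn (pseries (pseries_diffs a) z) =
  2 * lambda * (t - z) * limn (pseries a z).
Proof.
move=> ca cda.
set q := 1 - _ + _.
have aE k : k.+2%:R * a k.+2 =
    2 * (k.+1%:R + lambda) * t * a k.+1 - (k%:R + 2 * lambda) * a k.
  exact: gpoly_rec.
have E N : q * pseries (pseries_diffs a) z N - 2 * lambda * (t - z) * pseries a z N
   = 2 * lambda * t * (a N * z ^+ N) - pseries_diffs a N * z ^+ N
     + N%:R * a N * z ^+ N.+1.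
  elim: N => [|N IH].
    rewrite /pseries !seriesEnat /= !big_geq// /pseries_diffs /a /gpoly /=.
    by rewrite hornerC hornerZ hornerX !expr0 expr1; ring.
  have S1 (u : R^nat) : series u N.+1 = series u N + u N.
    by rewrite !seriesEnat /= big_nat_recr.
  rewrite /pseries !S1 -/(pseries _ z N) -/(pseries a z N).
  rewrite /pseries_diffs aE.
  have kE1 : N.+1%:R = N%:R + 1 :> R by rewrite -addn1 natrD.
  have -> : q * (pseries (pseries_diffs a) z N + N.+1%:R * a N.+1 * z ^+ N) -
     2 * lambda * (t - z) * (pseries a z N + a N * z ^+ N) =
     2 * lambda * t * (a N * z ^+ N) - pseries_diffs a N * z ^+ N
     + N%:R * a N * z ^+ N.+1 + q * (N.+1%:R * a N.+1 * z ^+ N)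
     - 2 * lambda * (t - z) * (a N * z ^+ N) by rewrite -IH; ring.
  by rewrite /q /pseries_diffs !exprS kE1; ring.
have a0 : (fun N => a N * z ^+ N) @ \oo --> 0 by exact: cvg_series_cvg_0 ca.
have d0 : (fun N => pseries_diffs a N * z ^+ N) @ \oo --> 0.
  exact: cvg_series_cvg_0 cda.
have e0 : (fun N => N%:R * a N * z ^+ N.+1) @ \oo --> 0.
  rewrite -cvg_shiftS.
  rewrite (_ : (fun _ => _) = (fun N => z ^+ 2 * (pseries_diffs a N * z ^+ N))).
    have := cvgM (cvg_cst (z ^+ 2)) d0; rewrite mulr0; exact.
  by apply/funext => N; rewrite /pseries_diffs !exprS /=; ring.
apply/eqP; rewrite -subr_eq0; apply/eqP.
have L : (fun N => q * pseries (pseries_diffs a) z N -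
    2 * lambda * (t - z) * pseries a z N) @ \oo -->
    q * limn (pseries (pseries_diffs a) z) -
    2 * lambda * (t - z) * limn (pseries a z).
  by apply: cvgB; apply: cvgM => //; exact: cvg_cst.
apply: (cvg_unique _ L) => //.
rewrite (_ : (fun _ => _) = (fun N => 2 * lambda * t * (a N * z ^+ N)
  - pseries_diffs a N * z ^+ N + N%:R * a N * z ^+ N.+1)); last exact/funext.
have := cvgD (cvgB (cvgM (cvg_cst (2 * lambda * t)) a0) d0) e0.
by rewrite mulr0 subr0 addr0; exact.
Qed.

Lemma is_gegenbauer_gpoly : is_gegenbauer lambda gpoly.
Proof.
move=> t; set a := fun k => (gpoly k).[t].
have [D0 D01 aD0] := gpoly_bound t.
pose D := D0 + 2 * `|t|.
have t0 : 0 <= 2 * `|t| by rewrite mulr_ge0.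
have D1 : 1 <= D by rewrite /D; apply: (le_trans D01); rewrite lerDl.
have Dgt0 : 0 < D by exact: lt_le_trans D1.
have aD k : `|a k| <= 1 * D ^+ k.
  rewrite mul1r (le_trans (aD0 k))// lerXn2r ?nnegrE ?lerDl//; last exact: ltW.
  exact: le_trans D01.
pose r := (8 * D)^-1.
have r0 : 0 < r by rewrite invr_gt0 mulr_gt0.
have Dr : 8 * D * r = 1 by rewrite mulfV// gt_eqF// mulr_gt0.
have rr : `|r| = r by rewrite ger0_norm// ltW.
have dD := diffs_dominated aD (ltW Dgt0).
have D20 : 0 <= 2 * D by rewrite mulr_ge0// ltW.
have D40 : 0 <= 2 * (2 * D) by rewrite mulr_ge0.
have ddD := diffs_dominated dD D20.
have ca : cvgn (pseries a r) by apply: (pseries_dominated aD (ltW Dgt0)); rewrite rr; nra.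
have cda : cvgn (pseries (pseries_diffs a) r).
  by apply: (pseries_dominated dD D20); rewrite rr; nra.
have cdda : cvgn (pseries (pseries_diffs (pseries_diffs a)) r).
  by apply: (pseries_dominated ddD D40); rewrite rr; nra.
pose S (z : R) : R := limn (pseries a z).
pose S' (z : R) : R := limn (pseries (pseries_diffs a) z).
have dS (z : R) : `|z| < r -> is_derive z 1 S (S' z).
  by move=> zr; apply: (@pseries_snd_diffs _ a r); rewrite ?rr.
have cz (z : R) : `|z| < r -> cvgn (pseries a z).
  by move=> zr; apply: is_cvg_pseries_inside ca _; rewrite rr.
have cdz (z : R) : `|z| < r -> cvgn (pseries (pseries_diffs a) z).
  by move=> zr; apply: is_cvg_pseries_inside cda _; rewrite rr.
pose q (z : R) : R := 1 - 2 * t * z + z ^+ 2.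
have q0 (z : R) : `|z| < r -> 0 < q z.
  move=> zr; have : `|2 * t * z| <= D * r.
    rewrite normrM; apply: ler_pM => //; last exact: ltW.
    by rewrite normrM ger0_norm// /D lerDr; exact: le_trans D01.
  rewrite ler_norml /q => /andP[_].
  have := sqr_ge0 z; move: (2 * t * z) (z ^+ 2) => u v; nra.
pose phi (z : R) : R := S z * q z `^ lambda.
have dphi (z : R) : `|z| < r -> is_derive z 1 phi 0.
  move=> zr; have ? := dS z zr; have qz := q0 z zr.
  have dq : is_derive z 1 q (- (2 * t) + 2 * z).
    rewrite /q; apply: is_derive_eq.
    by rewrite /GRing.scale /=; ring.
  have dp : is_derive z 1 (fun z => q z `^ lambda)
     (lambda * q z `^ (lambda - 1) * (- (2 * t) + 2 * z)).
    have dw := is_derive1_powR lambda qz.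
    exact: (@is_derive1_comp _ (fun w : R => w `^ lambda) q z _ _ dw dq).
  apply: is_derive_eq.
  have ode := gpoly_ode (cz z zr) (cdz z zr).
  have -> : q z `^ lambda = q z * q z `^ (lambda - 1).
    rewrite -{2}[q z]powRr1 ?ltW// -powRD; first by congr powR; ring.
    by rewrite (gt_eqF qz) implybT.
  rewrite /GRing.scale /=.
  transitivity (q z `^ (lambda - 1) * (q z * S' z - 2 * lambda * (t - z) * S z)).
    by ring.
  by rewrite /q /S' /S ode subrr mulr0.
have S0 : S 0 = 1.
  apply/cvg_lim => //; rewrite -cvg_shiftS.
  rewrite (_ : (fun _ => _) = cst 1); first exact: cvg_cst.
  apply/funext => N; rewrite /pseries seriesEnat /= big_nat_recl// big1 => [|i _].
    by rewrite addr0 expr0 mulr1 /a /gpoly /= hornerC.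
  by rewrite exprS mul0r mulr0.
have phi0 : phi 0 = 1.
  by rewrite /phi S0 /q mulr0 subr0 expr0n /= addr0 powR1 mulr1.
have phiE (z : R) : `|z| < r -> phi z = 1.
  move=> zr; rewrite -phi0.
  have din (x : R) : x \in `[Num.min 0 z, Num.max 0 z] -> `|x| < r.
    rewrite in_itv/= => /andP[]; move: zr; rewrite !ltr_norml => /andP[z1 z2].
    case: (leP 0 z) => _ x1 x2; apply/andP; split; lra.
  have mm : Num.min 0 z <= Num.max 0 z by case: (leP 0 z) => // /ltW.
  have [x xz||c _] := @MVT_segment _ phi (fun=> 0) (Num.min 0 z) (Num.max 0 z) mm.
  - by apply/dphi/din; exact: subset_itv_oo_cc xz.
  - by apply: derivable_within_continuous => x /din /dphi [].
  rewrite mul0r; case: (leP 0 z) => _ /eqP; rewrite subr_eq0 => /eqP //.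
near=> z.
have zr : `|z| < r.
  near: z; have := @nbhs0_lt _ R^o r r0; exact.
have := phiE z zr; rewrite /phi => pz.
have -> : (1 - 2 * t * z + z ^+ 2) `^ (- lambda) = S z.
  rewrite powRN -/(q z) -[RHS](mulfK (x := q z `^ lambda)) ?pz ?mul1r//.
  by rewrite gt_eqF// powR_gt0// q0.
exact: cz.
Unshelve. all: by end_near. Qed.


Lemma gegenbauerP : is_gegenbauer lambda (gegenbauer lambda).
Proof. by apply: xgetPex; exists gpoly; exact: is_gegenbauer_gpoly. Qed.

End gegenbauer_exists.

Section kernels.
Context {R : realType} {m : nat}.
Implicit Types (lambda : R) (M : nat) (x : 'rV[R]_m.+1) (y : 'rV[R]_m)
  (f : 'rV[R]_m -> R).

Definition K lambda x y' : R :=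
  (enorm (y' - bproj x) ^+ 2 + height x ^+ 2) `^ (- lambda).

Definition Kmod lambda M x y' : R :=
  K lambda x y' -
  \sum_(k < M) enorm y' ^+ k / enorm x `^ (k%:R + 2 * lambda)
               * (gegenbauer lambda k).[Theta x y'].

Definition Fmod lambda M f x : R :=
  \int[@completed_lebesgue_rV R m]_y' (f y' * Kmod lambda M x y').

Definition moment_finite M f : Prop :=
  (\int[@completed_lebesgue_rV R m]_y'
     (`|f y'| * (enorm y' ^+ M.-1 + 1))%:E < +oo)%E.

Definition growth lambda M x : R :=
  enorm x `^ (- (M%:R + 2 * lambda - 1)) * sec (theta x) `^ (2 * lambda).

End kernels.

(* Main.v *)
Require Import Defs.
From mathcomp Require Import all_boot all_order all_algebra.
From mathcomp Require Import all_classical all_reals all_analysis.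
From mathcomp Require Import measurable_realfun ring lra.
Set Implicit Arguments.
Unset Strict Implicit.
Unset Printing Implicit Defensive.
Import Order.TTheory GRing.Theory Num.Theory.
Import numFieldNormedType.Exports.
Local Open Scope classical_set_scope.
Local Open Scope ring_scope.

(** Write r = |x|, h = x_n for the height of x, z = |y'|/r and t = Theta.  By
    homogeneity the modified kernel is r^(-2 lambda) times
    (1 - 2tz + z^2)^(-lambda) - sum_(k < M) z^k C_k(t), and the growth function
    r^-(M+2 lambda-1) sec^(2 lambda) theta is just h^(-2 lambda) / r^(M-1).

    The estimate.  For z <= 1/2 the bracket is a Taylor remainder, O(z^M)
    uniformly in |t| <= 1 ([gegen_sum_remainder]).  For z > 1/2 the kernel K is at
    most h^(-2 lambda), and every subtracted term is O(r^(-2 lambda) z^(M-1)).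
    Together ([Kmod_bound]), the modified kernel is at most a constant times
    growth(x) |y'|^(M-1) min(1, |y'|/r).  Integrating against |f| and applying
    dominated convergence, with |f| (|y'|^(M-1) + 1) as majorant, gives the little o
    ([Fmod_little_o]).

    Sharpness.  The bound for the kernel is attained up to a constant: for every
    x there is y' with r <= |y'| <= C r at which the modified kernel is at least
    c h^(-2 lambda) in absolute value ([Kmod_lower]).  Indeed, on the line through
    the origin and the projection of x the subtracted sum is a polynomial of degree
    less than M in the abscissa.  If the modified kernel were small at M + 1
    equally spaced points, of which only the first is near the projection, then that
    polynomial would be of size h^(-2 lambda) at the first point and much
    smaller at the M others, which extrapolation forbids ([poly_extrapolation]).

    So a bump near such a y', of weighted mass at most one, is sent by the modified
    transform at x to a value at least c growth(x), whereas psi is o(growth).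
    This makes the functionals f |-> F[f](X_i)/psi(X_i) unbounded on the
    weighted L^1 space, and a gliding hump argument ([gliding_hump]) produces one f
    with which they do not tend to 0: f is a sum of bumps with geometrically
    decreasing coefficients whose signs are chosen one after the other.  As
    |y'| >= r at the centres, the bumps move off to infinity, so the sum is
    locally finite and f is continuous. *)
(** * Gegenbauer polynomials *)
Lemma nat_ind2 (P : nat -> Prop) :
  P 0 -> P 1 -> (forall k, P k -> P k.+1 -> P k.+2) -> forall k, P k.
Proof.
move=> P0 P1 PS k; suff [] : P k /\ P k.+1 by [].
by elim: k => [//|k [Pk Pk1]]; split => //; exact: PS.
Qed.

Section PowerSeries.
Context {R : realType}.
Implicit Type a : nat -> R.

(** Termwise differentiation, done inside the disc where the sum is known to
    vanish, turns the statement for the (k+1)-st coefficient into the one for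
    the k-th coefficient of the differentiated series. *)
Lemma pseries_vanish a : (\forall z \near (0 : R), pseries a z @ \oo --> (0 : R)) ->
  forall k, a k = 0.
Proof.
move=> az k; elim: k a az => [|k IH] a az.
  have [e /= e0 /(_ 0)] := az; rewrite /= subrr normr0 => /(_ e0) H.
  suff H0 : pseries a 0 @ \oo --> a 0 by apply/esym; exact: (cvg_unique _ H H0).
  rewrite -cvg_shiftS (_ : (fun _ => _) = cst (a 0)); first exact: cvg_cst.
  apply/funext => N; rewrite /pseries seriesEnat /= big_nat_recl// big1 => [|i _].
    by rewrite addr0 expr0 mulr1.
  by rewrite exprS mul0r mulr0.
suff : pseries_diffs a k = 0.
  by rewrite /pseries_diffs => /eqP; rewrite mulf_eq0 pnatr_eq0 /= => /eqP.
apply: IH; have [e /= e0 H] := az.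
have {}H z : `|z| < e -> pseries a z @ \oo --> (0 : R).
  by move=> ze; apply: H => /=; rewrite sub0r normrN.
pose K := e / 2.
have K0 : 0 < K by rewrite divr_gt0.
have Ke : `|K| < e by rewrite gtr0_norm// /K; lra.
have cK : cvgn (pseries a K) by apply/cvg_ex; exists 0; exact: H.
have [B [Br HB]] := cvg_series_bounded cK.
have {}HB n : `|a n| <= (B + 1) * (K^-1) ^+ n.
  have /HB /(_ n I) /= : B < B + 1 by rewrite ltrDl.
  rewrite normrM normrX (gtr0_norm K0) -ler_pdivlMr ?exprn_gt0//.
  by rewrite -exprVn.
have Ki0 : 0 <= K^-1 by rewrite invr_ge0 ltW.
have Ki1 : 0 <= 2 * K^-1 by rewrite mulr_ge0.
have Ki2 : 0 <= 2 * (2 * K^-1) by rewrite !mulr_ge0.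
have H1 := diffs_dominated HB Ki0.
have H2 := diffs_dominated H1 Ki1.
(* Two differentiations each halve the radius given by the geometric bound. *)
pose r := K / 8.
have r0 : 0 < r by rewrite divr_gt0.
have rr : `|r| = r by rewrite gtr0_norm.
have KK : K^-1 * K = 1 by rewrite mulVf// gt_eqF.
have ca : cvgn (pseries a r).
  by apply: (pseries_dominated HB) => //; rewrite rr /r; nra.
have cda : cvgn (pseries (pseries_diffs a) r).
  by apply: (pseries_dominated H1) => //; rewrite rr /r; nra.
have cdda : cvgn (pseries (pseries_diffs (pseries_diffs a)) r).
  by apply: (pseries_dominated H2) => //; rewrite rr /r; nra.
exists r => // z /=; rewrite sub0r normrN => zr.
have cz : cvgn (pseries (pseries_diffs a) z).
  by apply: is_cvg_pseries_inside cda _; rewrite rr.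
suff <- : limn (pseries (pseries_diffs a) z) = 0 by [].
have dS : is_derive z 1 (fun x => limn (pseries a x)) (limn (pseries (pseries_diffs a) z)).
  by apply: (@pseries_snd_diffs _ a r); rewrite ?rr.
have d0 : is_derive z 1 (cst (0 : R)) (0 : R) by exact: is_derive_cst.
suff dS0 : is_derive z 1 (fun x => limn (pseries a x)) (0 : R).
  by have [_ <-] := dS; have [_ ->] := dS0.
apply: near_eq_is_derive d0.
have : \forall y \near z, `|y| < r.
  have : (Num.norm y @[y --> z] --> `|z|) by exact: norm_continuous.
  by move=> /cvgr_lt /(_ _ zr).
apply: filterS => y yr; apply/esym/cvg_lim => //; apply: H; apply: lt_trans yr _.
by rewrite /r; move: Ke; rewrite gtr0_norm//; lra.
Qed.

End PowerSeries.

Section Gegenbauer.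
Context {R : realType}.

Lemma horner_bounded (p : {poly R}) : exists2 B, 0 <= B &
  forall t, `|t| <= 1 -> `|p.[t]| <= B.
Proof.
exists (\sum_(i < size p) `|p`_i|) => [|t t1]; first exact: sumr_ge0.
rewrite horner_coef; apply: (le_trans (ler_norm_sum _ _ _)); apply: ler_sum => i _.
by rewrite normrM normrX ler_piMr// exprn_ile1.
Qed.

Variable lambda : R.
Hypothesis l0 : 0 < lambda.

(** Both families satisfy the generating identity, which determines its
    coefficients; only [gpoly] comes with a recurrence. *)
Lemma gegenbauerE k (t : R) : (gegenbauer lambda k).[t] = (gpoly lambda k).[t].
Proof.
apply/eqP; rewrite -subr_eq0; apply/eqP; move: k.
apply: (@pseries_vanish R (fun k => (gegenbauer lambda k).[t] - (gpoly lambda k).[t])).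
have := gegenbauerP l0 t; have := is_gegenbauer_gpoly l0 t.
apply: filterS2 => z H1 H2.
suff -> : pseries (fun k => (gegenbauer lambda k).[t] - (gpoly lambda k).[t]) z =
    pseries (fun k => (gegenbauer lambda k).[t]) z \- pseries (fun k => (gpoly lambda k).[t]) z.
  by have := cvgB H2 H1; rewrite subrr; exact.
apply/funext => N; rewrite /pseries !seriesEnat /= -sumrB.
by apply: eq_bigr => i _; rewrite mulrBl.
Qed.

(** [hgegen k (|y|^2) (|y| t)] is |y|^k C_k(t).  Unlike C_k(Theta), whose argument
    jumps at y = 0, it is built from polynomial functions of y, which gives
    continuity there; pairs serve to run a recurrence of order two. *)
Fixpoint hgegen_pair (u tau : R) (k : nat) : R * R :=
  if k is k'.+1 then
    let p := hgegen_pair u tau k' in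
    (p.2, (2 * (k'.+1%:R + lambda) * tau * p.2 - (k'%:R + 2 * lambda) * u * p.1) / k'.+2%:R)
  else (1, 2 * lambda * tau).
Definition hgegen k u tau := (hgegen_pair u tau k).1.

Lemma hgegen_rec k u tau : k.+2%:R * hgegen k.+2 u tau =
  2 * (k.+1%:R + lambda) * tau * hgegen k.+1 u tau
  - (k%:R + 2 * lambda) * u * hgegen k u tau.
Proof.
by rewrite {1}/hgegen /= -/(hgegen k u tau) -/(hgegen k.+1 u tau) mulrC divfK.
Qed.

Lemma hgegen_scale k z u tau :
  hgegen k (z ^+ 2 * u) (z * tau) = z ^+ k * hgegen k u tau.
Proof.
elim/nat_ind2: k => [||k IH1 IH2].
- by rewrite /hgegen /= expr0 mulr1.
- by rewrite /hgegen /= expr1; ring.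
have k2 : k.+2%:R != 0 :> R by rewrite pnatr_eq0.
apply: (mulfI k2); rewrite hgegen_rec IH1 IH2.
rewrite [RHS]mulrCA hgegen_rec !exprS; ring.
Qed.

Lemma hgegen1 k t : hgegen k 1 t = (gegenbauer lambda k).[t].
Proof.
rewrite gegenbauerE; elim/nat_ind2: k => [||k IH1 IH2].
- by rewrite /hgegen /gpoly /= hornerC.
- by rewrite /hgegen /gpoly /= hornerZ hornerX.
have k2 : k.+2%:R != 0 :> R by rewrite pnatr_eq0.
by apply: (mulfI k2); rewrite hgegen_rec gpoly_rec IH1 IH2 mulr1.
Qed.

Let a t k := (gegenbauer lambda k).[t].
(** Partial sum of the series generated by [gen_base t z `^ (- lambda)]. *)
Definition gegen_sum M t z : R := \sum_(k < M) z ^+ k * a t k.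
Definition gen_base t z : R := 1 - 2 * t * z + z ^+ 2.

Lemma coef_rec t k : k.+2%:R * a t k.+2 =
    2 * (k.+1%:R + lambda) * t * a t k.+1 - (k%:R + 2 * lambda) * a t k.
Proof. by rewrite /a !gegenbauerE; exact: gpoly_rec. Qed.

(** The generating function solves q S' = 2 lambda (t - z) S with q = [gen_base].  By
    the recurrence, a partial sum fails to solve it only through the last
    two coefficients, hence up to O(z^M). *)
Lemma gegen_sum_ode M t z :
  gen_base t z * (\sum_(k < M.+1) k%:R * z ^+ k.-1 * a t k)
    - 2 * lambda * (t - z) * gegen_sum M.+1 t z =
  - (M.+1%:R * a t M.+1) * z ^+ M + (M%:R + 2 * lambda) * a t M * z ^+ M.+1.
Proof.
elim: M => [|M IH].
  rewrite /gegen_sum !big_ord_recr !big_ord0 /= /a !gegenbauerE /gpoly /= hornerC hornerZ hornerX.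
  by rewrite /gen_base; ring.
rewrite /gegen_sum !(big_ord_recr M.+1)/= -/(gegen_sum M.+1 t z).
set S' := \sum_(i < M.+1) _ in IH *.
transitivity (gen_base t z * S' - 2 * lambda * (t - z) * gegen_sum M.+1 t z
  + gen_base t z * (M.+1%:R * z ^+ M * a t M.+1) - 2 * lambda * (t - z) * (z ^+ M.+1 * a t M.+1)).
  ring.
rewrite IH mulrA coef_rec /gen_base !exprS -[M.+1%:R]natr1; ring.
Qed.

Lemma is_derive_gegen_sum M t (z : R) :
  is_derive z 1 (gegen_sum M t) (\sum_(k < M) k%:R * z ^+ k.-1 * a t k).
Proof.
rewrite /gegen_sum; elim: M => [|M IH].
  rewrite big_ord0 (_ : (fun _ => _) = cst 0); first exact: is_derive_cst.
  by apply/funext => ?; rewrite big_ord0.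
rewrite big_ord_recr/= (_ : (fun _ => _) =
  (fun z : R => \sum_(k < M) z ^+ k * a t k) \+ (fun z => z ^+ M * a t M)); last first.
  by apply/funext => ?; rewrite big_ord_recr.
apply: is_deriveD.
have dX : is_derive z 1 (fun y : R => y ^+ M) (M%:R * z ^+ M.-1).
  have := @is_deriveX _ _ (@id R) M z 1 1 (is_derive_id _ _).
  rewrite /GRing.scale /= mulr1; congr is_derive.
  by apply/funext => y; rewrite fctE.
rewrite (_ : (fun _ => _) = (a t M) \*: (fun y : R => y ^+ M)); last first.
  by apply/funext => y; rewrite mulrC.
by apply: is_derive_eq; rewrite /GRing.scale /= mulrC.
Qed.

Lemma gen_base_ge t z : `|t| <= 1 -> 0 <= z <= 1/2 -> 1/4 <= gen_base t z.
Proof.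
rewrite ler_norml => /andP[t1 t2] /andP[z0 z1]; rewrite /gen_base.
nra.
Qed.

Lemma gen_base_le t z : `|t| <= 1 -> 0 <= z <= 1/2 -> gen_base t z <= 4.
Proof.
rewrite ler_norml => /andP[t1 t2] /andP[z0 z1]; rewrite /gen_base.
nra.
Qed.

(** With q = [gen_base], the derivative of phi = S q^lambda is
    q^(lambda - 1) times the defect of S in the differential equation, so
    phi = 1 + O(z^(M+1)) by the mean value theorem, and
    q^(-lambda) - S = q^(-lambda) (1 - phi).  Working with finite sums makes the
    constant uniform in t and avoids all questions of convergence. *)
Lemma gegen_sum_remainder M : exists2 C, 0 <= C &
  forall t z, `|t| <= 1 -> 0 <= z <= 1/2 ->
  `|gen_base t z `^ (- lambda) - gegen_sum M.+1 t z| <= C * z ^+ M.+1.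
Proof.
have [B1 B10 HB1] := horner_bounded (gegenbauer lambda M.+1).
have [B0 B00 HB0] := horner_bounded (gegenbauer lambda M).
pose C1 := M.+1%:R * B1 + (M%:R + 2 * lambda) * B0.
have Ml : 0 <= M%:R + 2 * lambda by rewrite addr_ge0// mulr_ge0// ltW.
have C10 : 0 <= C1 by rewrite addr_ge0// mulr_ge0.
pose D := 4 `^ lambda.
have D0 : 0 < D by rewrite powR_gt0.
exists (D * (D * 4 * C1)) => [|t z t1 z01].
  by rewrite !mulr_ge0// ltW.
pose S := gegen_sum M.+1 t.
pose phi (y : R) := S y * gen_base t y `^ lambda.
pose rem (y : R) := - (M.+1%:R * a t M.+1) * y ^+ M + (M%:R + 2 * lambda) * a t M * y ^+ M.+1.
have qge y : 0 <= y <= 1/2 -> 1/4 <= gen_base t y by move=> ?; exact: gen_base_ge.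
have q0 y : 0 <= y <= 1/2 -> 0 < gen_base t y by move=> /qge; apply: lt_le_trans.
have dphi (y : R) : 0 <= y <= 1/2 -> is_derive y 1 phi (gen_base t y `^ (lambda - 1) * rem y).
  move=> y01; have qy := q0 y y01.
  have ? := is_derive_gegen_sum M.+1 t y.
  have dq : is_derive y 1 (gen_base t) (- (2 * t) + 2 * y).
    rewrite /gen_base; apply: is_derive_eq.
    by rewrite /GRing.scale /=; ring.
  have dp : is_derive y 1 (fun z => gen_base t z `^ lambda)
     (lambda * gen_base t y `^ (lambda - 1) * (- (2 * t) + 2 * y)).
    have dw := is_derive1_powR lambda qy.
    exact: (@is_derive1_comp _ (fun w : R => w `^ lambda) (gen_base t) y _ _ dw dq).
  apply: is_derive_eq.
  have -> : gen_base t y `^ lambda = gen_base t y * gen_base t y `^ (lambda - 1).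
    rewrite -{2}[gen_base t y]powRr1 ?ltW// -powRD; first by congr powR; ring.
    by rewrite (gt_eqF qy) implybT.
  rewrite /rem -gegen_sum_ode /GRing.scale /= -/S; ring.
have z0 : 0 <= z by case/andP: z01.
have zh : z <= 1/2 by case/andP: z01.
have phi0 : phi 0 = 1.
  rewrite /phi /S /gegen_sum big_ord_recl big1 => [|i _]; last by rewrite exprS mul0r mul0r.
  rewrite /gen_base mulr0 subr0 expr0 expr2 mulr0 !addr0 powR1 mulr1 mul1r.
  by rewrite /a gegenbauerE /gpoly /= hornerC.
have Hphi : `|phi z - 1| <= D * 4 * C1 * z ^+ M.+1.
  rewrite -[X in _ - X]phi0.
  have [x||x xz ->] := @MVT_segment _ phi (fun y => gen_base t y `^ (lambda - 1) * rem y) 0 z z0.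
  - rewrite in_itv /= => /andP[x0 xz]; apply: dphi; rewrite (ltW x0) /=.
    exact: ltW (lt_le_trans xz zh).
  - apply: derivable_within_continuous => x.
    rewrite in_itv /= => /andP[x0 xz]; apply: (@ex_derive _ _ _ _ _ _ _ (dphi x _)).
    by rewrite x0 /= (le_trans xz).
  move: xz; rewrite in_itv /= => /andP[x0 xz].
  have x01 : 0 <= x <= 1/2 by rewrite x0 (le_trans xz).
  rewrite subr0 !normrM (ger0_norm z0) exprSr mulrA; apply: ler_wpM2r => //.
  rewrite ger0_norm ?powR_ge0// -mulrA; apply: ler_pM => //; first exact: powR_ge0.
    have qx := q0 x x01.
    rewrite powRB ?(gt_eqF qx) ?implybT// powRr1 ?(ltW qx)//.
    rewrite /D ler_pM ?powR_ge0 ?invr_ge0 ?(ltW qx)//.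
      by apply: ge0_ler_powR; rewrite ?nnegrE ?(ltW l0) ?(ltW qx)// gen_base_le.
    by rewrite -[X in X <= _]mul1r ler_pdivrMr//; have := qge x x01; lra.
  rewrite /rem (le_trans (ler_normD _ _))// /C1 [leRHS]mulrDl; apply: lerD.
    rewrite !normrM normrN normrM (ger0_norm (ler0n _ _)) normrX (ger0_norm x0).
    rewrite ler_pM// ?mulr_ge0 ?exprn_ge0//; last by rewrite lerXn2r.
    by apply: ler_pM => //; exact: HB1.
  rewrite !normrM (ger0_norm Ml) normrX (ger0_norm x0).
  rewrite ler_pM// ?mulr_ge0 ?exprn_ge0//.
    by apply: ler_pM => //; exact: HB0.
  rewrite exprS (@le_trans _ _ (1 * x ^+ M)) ?ler_wpM2r ?exprn_ge0//.
    by apply: (le_trans xz); apply: (le_trans zh); lra.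
  by rewrite mul1r lerXn2r.
have qz := q0 z z01.
have -> : gen_base t z `^ (- lambda) - gegen_sum M.+1 t z =
    gen_base t z `^ (- lambda) * (1 - phi z).
  by rewrite mulrBr mulr1 /phi -/S mulrCA powRN mulVf ?mulr1// gt_eqF// powR_gt0.
rewrite normrM distrC ger0_norm ?powR_ge0// -[leRHS]mulrA ler_pM ?powR_ge0//.
rewrite powRN -[X in X <= _]mul1r ler_pdivrMr ?powR_gt0// /D -powRM ?(ltW qz)//.
have p1 : 1 `^ lambda = 1 :> R by rewrite powR1.
rewrite -[X in X <= _]p1; apply: ge0_ler_powR; rewrite ?nnegrE ?(ltW l0)//.
  by rewrite mulr_ge0// (ltW qz).
by have := qge z z01; lra.
Qed.

End Gegenbauer.

(** * Euclidean norm on row vectors *)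
Section Euclid.
Context {R : realType} {m : nat}.
Implicit Types u v w : 'rV[R]_m.

Lemma dotpC u v : dotp u v = dotp v u.
Proof. by apply: eq_bigr => i _; rewrite mulrC. Qed.

Lemma dotpDl u v w : dotp (u + v) w = dotp u w + dotp v w.
Proof. by rewrite -big_split; apply: eq_bigr => i _ /=; rewrite mxE mulrDl. Qed.

Lemma dotpZl c u v : dotp (c *: u) v = c * dotp u v.
Proof. by rewrite mulr_sumr; apply: eq_bigr => i _ /=; rewrite mxE mulrA. Qed.

Lemma dotpDr u v w : dotp w (u + v) = dotp w u + dotp w v.
Proof. by rewrite dotpC dotpDl !(dotpC w). Qed.

Lemma dotpZr c u v : dotp u (c *: v) = c * dotp u v.
Proof. by rewrite dotpC dotpZl dotpC. Qed.

Lemma dotpNl u v : dotp (- u) v = - dotp u v.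
Proof. by rewrite -scaleN1r dotpZl mulN1r. Qed.

Lemma dotpNr u v : dotp u (- v) = - dotp u v.
Proof. by rewrite dotpC dotpNl dotpC. Qed.

Lemma dotp_ge0 u : 0 <= dotp u u.
Proof. by apply: sumr_ge0 => i _; rewrite -expr2 sqr_ge0. Qed.

Lemma enorm_ge0 u : 0 <= enorm u.
Proof. exact: sqrtr_ge0. Qed.

Lemma enorm_sqr u : enorm u ^+ 2 = dotp u u.
Proof. by rewrite sqr_sqrtr// dotp_ge0. Qed.

Lemma ler_coord_enorm v i : `|v ord0 i| <= enorm v.
Proof.
rewrite -(@ler_pXn2r _ 2)// ?nnegrE ?enorm_ge0// enorm_sqr real_normK ?num_real//.
rewrite /dotp (bigD1 i)//= -expr2 lerDl; apply: sumr_ge0 => j _.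
by rewrite -expr2 sqr_ge0.
Qed.

Lemma enorm0 : enorm (0 : 'rV[R]_m) = 0.
Proof. by rewrite /enorm /dotp big1 ?sqrtr0// => i _; rewrite mxE mul0r. Qed.

Lemma enorm_eq0 u : (enorm u == 0) = (u == 0).
Proof.
apply/idP/eqP => [/eqP u0|->]; last by rewrite enorm0.
apply/rowP => i; rewrite mxE; apply/eqP; rewrite -normr_le0 -u0.
exact: ler_coord_enorm.
Qed.

Lemma enorm_gt0 u : (0 < enorm u) = (u != 0).
Proof. by rewrite lt_def enorm_eq0 enorm_ge0 andbT. Qed.

Lemma enormZ c u : enorm (c *: u) = `|c| * enorm u.
Proof.
by rewrite /enorm dotpZl dotpZr mulrA -expr2 sqrtrM ?sqr_ge0// sqrtr_sqr.
Qed.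

Lemma enormN u : enorm (- u) = enorm u.
Proof. by rewrite /enorm dotpNl dotpNr opprK. Qed.

Lemma cauchy_schwarz u v : `|dotp u v| <= enorm u * enorm v.
Proof.
have [->|v0] := eqVneq v 0.
  rewrite enorm0 mulr0 /dotp big1 ?normr0// => i _.
  by rewrite mxE mulr0.
have vv : 0 < dotp v v by rewrite -enorm_sqr exprn_gt0// enorm_gt0.
rewrite -(@ler_pXn2r _ 2)// ?nnegrE ?mulr_ge0 ?enorm_ge0// exprMn !enorm_sqr.
rewrite real_normK ?num_real// -(ler_pM2r vv).
have := dotp_ge0 (dotp v v *: u - dotp u v *: v).
rewrite dotpDl !dotpDr !(dotpNl, dotpNr) !(dotpZl, dotpZr) (dotpC v u); nra.
Qed.

Lemma ler_enormD u v : enorm (u + v) <= enorm u + enorm v.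
Proof.
rewrite -(@ler_pXn2r _ 2)// ?nnegrE ?addr_ge0 ?enorm_ge0// sqrrD !enorm_sqr.
rewrite dotpDl !dotpDr (dotpC v u).
have := cauchy_schwarz u v; rewrite ler_norml => /andP[_]; lra.
Qed.

Lemma ler_enormB u v : `|enorm u - enorm v| <= enorm (u - v).
Proof.
rewrite ler_norml.
have := ler_enormD (u - v) v; rewrite subrK.
have := ler_enormD (v - u) u; rewrite subrK -(enormN (v - u)) opprB; lra.
Qed.

Lemma enorm_le_sum v : enorm v <= \sum_i `|v ord0 i|.
Proof.
rewrite -(@ler_pXn2r _ 2)// ?nnegrE ?enorm_ge0 ?sumr_ge0// enorm_sqr expr2 /dotp.
rewrite mulr_suml; apply: ler_sum => i _.
apply: (le_trans (ler_norm _)); rewrite normrM ler_wpM2l//.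
by rewrite (bigD1 i)//= lerDl sumr_ge0.
Qed.

Lemma exists_unit_along u : (0 < m)%N ->
  exists2 e : 'rV[R]_m, enorm e = 1 & u = enorm u *: e.
Proof.
move=> m0; have [->|u0] := eqVneq u 0.
  exists (delta_mx ord0 (Ordinal m0)); last by rewrite enorm0 scale0r.
  rewrite /enorm /dotp (bigD1 (Ordinal m0))//= big1 => [|i i0].
    by rewrite addr0 !mxE !eqxx mulr1 sqrtr1.
  by rewrite !mxE (negbTE i0) andbF mulr0.
have un : enorm u != 0 by rewrite enorm_eq0.
exists ((enorm u)^-1 *: u); last by rewrite scalerA mulfV// scale1r.
by rewrite enormZ ger0_norm ?invr_ge0 ?enorm_ge0// mulVf.
Qed.

End Euclid.

(** * The modified kernel on the half space *)
Section HalfSpace.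
Context {R : realType} {m : nat}.
Implicit Types (x : 'rV[R]_m.+1) (y : 'rV[R]_m).

Lemma enorm_bproj x : enorm x ^+ 2 = enorm (bproj x) ^+ 2 + height x ^+ 2.
Proof.
rewrite !enorm_sqr /dotp big_ord_recr /= -expr2; congr (_ + _).
apply: eq_bigr => i _; rewrite !mxE.
by congr (x _ _ * x _ _); apply/val_inj.
Qed.

Lemma height_le_enorm x : height x <= enorm x.
Proof. by apply: le_trans (ler_norm _) (ler_coord_enorm _ _). Qed.

Lemma half_space_enorm_gt0 x : half_space x -> 0 < enorm x.
Proof. by move=> hx; apply: (lt_le_trans hx); exact: height_le_enorm. Qed.

Lemma bproj_le_enorm x : enorm (bproj x) <= enorm x.
Proof.
by rewrite -(@ler_pXn2r _ 2)// ?nnegrE ?enorm_ge0// (enorm_bproj x) lerDl sqr_ge0.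
Qed.

Lemma height_quotient x : half_space x -> 0 < height x / enorm x <= 1.
Proof.
move=> hx; have r0 := half_space_enorm_gt0 hx.
by rewrite divr_gt0// ler_pdivrMr// mul1r height_le_enorm.
Qed.

Lemma sec_theta x : half_space x -> sec (theta x) = enorm x / height x.
Proof.
move=> hx; have /andP[c0 c1] := height_quotient hx.
by rewrite /sec /theta acosK ?invf_div// in_itv /= c1 andbT; lra.
Qed.

Lemma sin_theta x : half_space x -> sin (theta x) = enorm (bproj x) / enorm x.
Proof.
move=> hx; have /andP[c0 c1] := height_quotient hx.
have r0 := half_space_enorm_gt0 hx.
rewrite /theta sin_acos; last by rewrite c1 andbT; lra.
have -> : 1 - (height x / enorm x) ^+ 2 = (enorm (bproj x) / enorm x) ^+ 2.
  by rewrite !expr_div_n (enorm_bproj x); field; rewrite -enorm_bproj expf_neq0// gt_eqF.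
by rewrite sqrtr_sqr ger0_norm// divr_ge0// enorm_ge0.
Qed.

(** When y or the projection of x is 0, the right side vanishes, using 1/0 = 0; so
    does the left one, because of the convention theta' = pi/2. *)
Lemma ThetaE x y : half_space x ->
  Theta x y = dotp (bproj x) y / (enorm x * enorm y).
Proof.
move=> hx; rewrite /Theta sin_theta// /theta' /angle.
case: ifPn => [/orP[/eqP ->|/eqP ->]|].
- by rewrite enorm0 !mul0r /dotp big1 ?mul0r// => i _; rewrite mxE mul0r.
- by rewrite enorm0 mulr0 invr0 mulr0 cos_pihalf mulr0.
rewrite negb_or -!enorm_gt0 => /andP[u0 v0].
have r0 := half_space_enorm_gt0 hx.
rewrite acosK; first by field; rewrite !gt_eqF.
have := cauchy_schwarz (bproj x) y; rewrite in_itv /= -ler_norml.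
by rewrite normrM normfV (ger0_norm (mulr_ge0 (ltW u0) (ltW v0))) ler_pdivrMr ?mulr_gt0// mul1r.
Qed.

Lemma Theta_le1 x y : half_space x -> `|Theta x y| <= 1.
Proof.
move=> hx; rewrite ThetaE//.
have r0 := half_space_enorm_gt0 hx.
have [->|] := eqVneq y 0; first by rewrite enorm0 mulr0 invr0 mulr0 normr0.
rewrite -enorm_gt0 => y0.
rewrite normrM normfV [`|_ * enorm y|]gtr0_norm ?mulr_gt0// ler_pdivrMr ?mulr_gt0// mul1r.
by apply: (le_trans (cauchy_schwarz _ _)); rewrite ler_pM2r// bproj_le_enorm.
Qed.

Lemma dotp_Theta x y : half_space x ->
  dotp (bproj x) y = enorm x * (enorm y * Theta x y).
Proof.
move=> hx; rewrite ThetaE//.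
have r0 := half_space_enorm_gt0 hx.
have [->|] := eqVneq y 0.
  by rewrite enorm0 mul0r mulr0 /dotp big1// => i _; rewrite [X in _ * X]mxE mulr0.
by rewrite -enorm_gt0 => y0; field; rewrite !gt_eqF.
Qed.

Lemma K_baseE x y : enorm (y - bproj x) ^+ 2 + height x ^+ 2 =
  enorm y ^+ 2 - 2 * dotp (bproj x) y + enorm x ^+ 2.
Proof.
rewrite (enorm_bproj x) !enorm_sqr dotpDl !dotpDr !(dotpNl, dotpNr) (dotpC y); ring.
Qed.

Variable lambda : R.
Hypothesis l0 : 0 < lambda.

(** Since sec theta = |x|/h, the powers of |x| combine. *)
Lemma growthE M x : half_space x ->
  growth lambda M.+1 x = height x `^ (- (2 * lambda)) / enorm x ^+ M.
Proof.
move=> hx; have r0 := half_space_enorm_gt0 hx.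
have /andP[c0 c1] := height_quotient hx.
rewrite /growth sec_theta// powRM ?invr_ge0 ?(ltW r0) ?(ltW hx)//.
rewrite -(powR_inv1 (ltW hx)) -powRrM mulN1r mulrA -powRD; last first.
  by rewrite (gt_eqF r0) implybT.
rewrite mulrC; congr (_ * _); rewrite -powR_mulrn ?(ltW r0)// -powRN; congr (_ `^ _).
by rewrite -natr1; ring.
Qed.

Lemma growth_gt0 M x : half_space x -> 0 < growth lambda M.+1 x.
Proof.
move=> hx; have r0 := half_space_enorm_gt0 hx.
by rewrite growthE// divr_gt0 ?powR_gt0// exprn_gt0.
Qed.

(** Polynomial form of the subtracted sum, valid at y = 0 too: it gives continuity
    in y and restricts to a polynomial on each line through the origin. *)
Lemma KmodE M x y : half_space x -> Kmod lambda M x y =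
  K lambda x y - \sum_(k < M) hgegen lambda k (enorm y ^+ 2) (dotp (bproj x) y / enorm x)
    / enorm x `^ (k%:R + 2 * lambda).
Proof.
move=> hx; have r0 := half_space_enorm_gt0 hx.
congr (_ - _); apply: eq_bigr => k _.
rewrite mulrAC; congr (_ / _); rewrite -hgegen1// -hgegen_scale// mulr1 dotp_Theta//.
by congr (hgegen _ _ _ _); field; rewrite gt_eqF.
Qed.

Lemma Kmod_scaled M x y : half_space x -> Kmod lambda M x y =
  enorm x `^ (- (2 * lambda)) * (gen_base (Theta x y) (enorm y / enorm x) `^ (- lambda)
    - gegen_sum lambda M (Theta x y) (enorm y / enorm x)).
Proof.
move=> hx; have r0 := half_space_enorm_gt0 hx.
rewrite mulrBr; congr (_ - _).
  have -> : - (2 * lambda) = 2 * (- lambda) by rewrite mulrN.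
  rewrite powRrM powR_mulrn ?(ltW r0)// -powRM ?sqr_ge0//.
    rewrite /K K_baseE dotp_Theta//; congr (_ `^ _).
    by rewrite /gen_base; field; rewrite gt_eqF.
  have := Theta_le1 y hx; rewrite ler_norml => /andP[t1 t2].
  rewrite /gen_base; have : 0 <= enorm y / enorm x by rewrite divr_ge0 ?enorm_ge0.
  move: (Theta _ _) (enorm y / enorm x) t1 t2 => t z t1 t2 z0.
  have := sqr_ge0 (z - t).
  have : 0 <= (1 - t) * (1 + t) by rewrite mulr_ge0//; lra.
  nra.
rewrite /gegen_sum mulr_sumr; apply: eq_bigr => k _.
rewrite powRD; last by rewrite (gt_eqF r0) implybT.
rewrite powR_mulrn ?(ltW r0)// powRN expr_div_n; field.
by rewrite !gt_eqF ?powR_gt0 ?exprn_gt0.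
Qed.

(** Near the origin (|y|/|x| <= 1/2) the Taylor remainder is used.  Farther out
    all the powers of |y|/|x| involved are bounded by the top one up to a factor
    2^M, and there is nothing to gain from cancellation. *)
Lemma Kmod_bound M : exists2 C, 0 < C & forall x y, half_space x ->
  `|Kmod lambda M.+1 x y| <=
    C * growth lambda M.+1 x * (enorm y ^+ M * Num.min 1 (enorm y / enorm x)).
Proof.
have [C0 C00 HC0] := gegen_sum_remainder l0 M.
have [B HB] : exists B : nat -> R, forall k, 0 <= B k /\ forall t, `|t| <= 1 ->
    `|(gegenbauer lambda k).[t]| <= B k.
  have /choice[B HB] : forall k, exists b : R, 0 <= b /\ forall t, `|t| <= 1 ->
      `|(gegenbauer lambda k).[t]| <= b.
    by move=> k; have [b b0 Hb] := horner_bounded (gegenbauer lambda k); exists b.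
  by exists B.
pose SB := \sum_(k < M.+1) B k.
have SB0 : 0 <= SB by apply: sumr_ge0 => i _; case: (HB i).
pose C := C0 + 2 ^+ M.+1 * (1 + SB).
exists C => [|x y hx].
  by rewrite ltr_wpDl// mulr_gt0// ltr_wpDr.
have r0 := half_space_enorm_gt0 hx.
have := Theta_le1 y hx; set t := Theta x y => t1.
have z0 : 0 <= enorm y / enorm x by rewrite divr_ge0 ?enorm_ge0.
have hr : enorm x `^ (- (2 * lambda)) <= height x `^ (- (2 * lambda)).
  rewrite !powRN lef_pV2 ?posrE ?powR_gt0//.
  apply: ge0_ler_powR; rewrite ?nnegrE ?(ltW r0) ?(ltW hx) ?mulr_ge0 ?(ltW l0)//.
  exact: height_le_enorm.
have h0 : 0 < height x `^ (- (2 * lambda)) by rewrite powR_gt0.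
rewrite growthE//.
have -> : C * (height x `^ (- (2 * lambda)) / enorm x ^+ M) *
   (enorm y ^+ M * Num.min 1 (enorm y / enorm x)) =
   height x `^ (- (2 * lambda)) * (C * ((enorm y / enorm x) ^+ M * Num.min 1 (enorm y / enorm x))).
  by rewrite expr_div_n; field; rewrite expf_neq0// gt_eqF.
have [zh|zh] := leP (enorm y / enorm x) (1/2).
  rewrite Kmod_scaled// -/t; set z := enorm y / enorm x in z0 zh *.
  rewrite normrM ger0_norm ?powR_ge0//.
  apply: ler_pM => //; first exact: powR_ge0.
  apply: (le_trans (HC0 t z t1 _)); first by rewrite z0.
  rewrite exprSr min_r; last lra.
  apply: ler_wpM2r; first by rewrite mulr_ge0// exprn_ge0.
  by rewrite /C lerDl mulr_ge0// addr_ge0.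
rewrite /Kmod (le_trans (ler_normB _ _))//.
set z := enorm y / enorm x in z0 zh *.
(* From here on 2 z > 1, so that 2 min(1, z) >= 1 as well. *)
have zM : 1 <= 2 ^+ M.+1 * (z ^+ M * Num.min 1 z).
  have -> : 2 ^+ M.+1 * (z ^+ M * Num.min 1 z) = (2 * z) ^+ M * (2 * Num.min 1 z).
    by rewrite exprS [(2 * z) ^+ M]exprMn; ring.
  have z2 : 1 <= 2 * z by lra.
  have zm : 1 <= 2 * Num.min 1 z by case: (leP 1 z) => _; lra.
  by rewrite -[X in X <= _]mulr1 ler_pM// exprn_ege1.
have zk k : (k <= M)%N -> z ^+ k <= 2 ^+ M.+1 * (z ^+ M * Num.min 1 z).
  move=> kM.
  have -> : 2 ^+ M.+1 * (z ^+ M * Num.min 1 z) = (2 * z) ^+ M * (2 * Num.min 1 z).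
    by rewrite exprS [(2 * z) ^+ M]exprMn; ring.
  have z2 : 1 <= 2 * z by lra.
  have zm : 1 <= 2 * Num.min 1 z by case: (leP 1 z) => _; lra.
  rewrite -[X in X <= _]mulr1 ler_pM// ?exprn_ge0//.
  apply: (@le_trans _ _ ((2 * z) ^+ k)); last by rewrite ler_weXn2l.
  by rewrite lerXn2r ?nnegrE//; lra.
have KK : `|K lambda x y| <= height x `^ (- (2 * lambda)).
  rewrite ger0_norm ?powR_ge0// /K !powRN lef_pV2 ?posrE ?powR_gt0//; last first.
    by rewrite ltr_wpDl ?sqr_ge0// exprn_gt0.
  rewrite powRrM powR_mulrn ?(ltW hx)//; apply: ge0_ler_powR; rewrite ?(ltW l0) ?nnegrE ?sqr_ge0//.
    by rewrite addr_ge0// sqr_ge0.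
  by rewrite lerDr sqr_ge0.
have SS : `|\sum_(k < M.+1) enorm y ^+ k / enorm x `^ (k%:R + 2 * lambda)
      * (gegenbauer lambda k).[t]| <= height x `^ (- (2 * lambda)) * (SB * (2 ^+ M.+1 * (z ^+ M * Num.min 1 z))).
  rewrite /SB mulr_suml mulr_sumr (le_trans (ler_norm_sum _ _ _))//.
  apply: ler_sum => k _.
  have -> : enorm y ^+ k / enorm x `^ (k%:R + 2 * lambda) = enorm x `^ (- (2 * lambda)) * z ^+ k.
    rewrite powRD; last by rewrite (gt_eqF r0) implybT.
    rewrite powR_mulrn ?(ltW r0)// powRN /z expr_div_n; field.
    by rewrite !gt_eqF ?powR_gt0 ?exprn_gt0.
  rewrite normrM ger0_norm ?mulr_ge0 ?powR_ge0 ?exprn_ge0// -mulrA ler_pM ?powR_ge0//.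
    by rewrite mulr_ge0 ?exprn_ge0.
  have [Bk0 HBk] := HB k.
  rewrite mulrC ler_pM ?exprn_ge0//; first exact: HBk.
  by apply: zk; rewrite -ltnS.
apply: (le_trans (lerD KK SS)).
rewrite -[X in X + _]mulr1 -mulrDr ler_pM2l//.
apply: (@le_trans _ _ ((1 + SB) * (2 ^+ M.+1 * (z ^+ M * Num.min 1 z)))).
  by rewrite [leRHS]mulrDl mul1r lerD2r.
rewrite mulrCA mulrA; apply: ler_wpM2r.
  by rewrite mulr_ge0 ?exprn_ge0// le_min ler01 z0.
by rewrite /C lerDr.
Qed.

End HalfSpace.

(** * A lower bound for the modified kernel *)
Section Extrapolation.
Context {R : realType}.

Lemma size_poly_shift_sub M (p : {poly R}) (c : R) : (size p <= M.+1)%N ->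
  (size (p \Po ('X + c%:P) - p)%R <= M)%N.
Proof.
elim: M p => [|M IH] p.
  by move=> /size1_polyC ->; rewrite comp_polyC subrr size_poly0.
elim/poly_ind: p => [|q b _] sp; first by rewrite comp_poly0 subrr size_poly0.
have sq : (size q <= M.+1)%N.
  by move: sp; rewrite size_MXaddC; case: ifP => [/andP[/eqP -> _]|//]; rewrite size_poly0.
have -> : (q * 'X + b%:P) \Po ('X + c%:P) - (q * 'X + b%:P) =
   (q \Po ('X + c%:P) - q) * 'X + c *: (q \Po ('X + c%:P)).
  rewrite comp_polyD comp_polyM comp_polyX comp_polyC -mul_polyC; ring.
rewrite (leq_trans (size_polyD _ _))// geq_max; apply/andP; split.
  have [->|d0] := eqVneq (q \Po ('X + c%:P) - q) 0; first by rewrite mul0r size_poly0.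
  by rewrite size_mulX// ltnS; exact: IH.
by rewrite (leq_trans (size_scale_leq _ _))// size_comp_poly2// size_XaddC.
Qed.

(** Newton's forward differences: the M-th difference of p vanishes, so
    p(a) is a combination of the values at the M next nodes whose coefficients are
    binomial, of total absolute value 2^M - 1. *)
Lemma poly_extrapolation M (p : {poly R}) (a L B : R) : (size p <= M)%N ->
  (forall j, (0 < j <= M)%N -> `|p.[a + j%:R * L]| <= B) ->
  `|p.[a]| <= (2 ^+ M - 1) * B.
Proof.
elim: M p B => [|M IH] p B sp HB.
  by move: sp; rewrite leqn0 size_poly_eq0 => /eqP ->; rewrite horner0 normr0 expr0 subrr mul0r.
have /IH := size_poly_shift_sub L sp => /(_ (2 * B)).
have E z : (p \Po ('X + L%:P) - p).[z] = p.[z + L] - p.[z].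
  by rewrite !hornerE horner_comp !hornerE.
have H j : (0 < j <= M)%N -> `|(p \Po ('X + L%:P) - p).[a + j%:R * L]| <= 2 * B.
  move=> /andP[j0 jM]; rewrite E.
  have -> : a + j%:R * L + L = a + j.+1%:R * L by rewrite -natr1; ring.
  have H1 := HB j.+1; have H2 := HB j.
  rewrite (le_trans (ler_normB _ _))// [leRHS]mulr_natl mulr2n lerD//; first exact: H1.
  by apply: H2; rewrite j0 leqW.
move=> /(_ H); rewrite E.
have := HB 1%N isT; rewrite mul1r => H1 H2.
have : `|p.[a]| <= `|p.[a + L]| + `|p.[a + L] - p.[a]|.
  by rewrite -{1}(subKr p.[a + L] p.[a]) ler_normB.
rewrite exprS; move: (2 ^+ M) H1 H2 => u H1 H2 H3.
apply: (le_trans H3); apply: (le_trans (lerD H1 H2)); lra.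
Qed.

End Extrapolation.

Section LowerBound.
Context {R : realType} {m : nat}.
Variable lambda : R.
Hypothesis l0 : 0 < lambda.
Hypothesis m0 : (0 < m)%N.

(** Let b be the norm of the projection of x and e a unit vector along it.  The
    test points are (b + h + j L r) e for 0 <= j <= M.  At the first one K is
    (2 h^2)^(-lambda); at the others it is at most (L h)^(-2 lambda), which is
    negligible for L large.  Shifting by h, and not starting at the projection
    itself, makes all these points at least as far from the origin as x. *)
Lemma Kmod_lower M : exists c C, [/\ 0 < c, 1 <= C & forall x : 'rV[R]_m.+1, half_space x ->
  exists y, [/\ enorm x <= enorm y, enorm y <= C * enorm x &
    c * height x `^ (- (2 * lambda)) <= `|Kmod lambda M x y| ]].
Proof.
(* L is such that 2^M L^(-2 lambda) is a quarter of 2^(-lambda), the ratio of K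
   to h^(-2 lambda) at the first point. *)
pose A := 4 * 2 ^+ M * 2 `^ lambda : R.
have A0 : 0 < A by rewrite !mulr_gt0// ?powR_gt0// exprn_gt0.
pose L := A `^ (2 * lambda)^-1.
have L0 : 0 < L by rewrite powR_gt0.
have ll0 : 0 < 2 * lambda by rewrite mulr_gt0.
have LA : L `^ (2 * lambda) = A by rewrite /L -powRrM mulVf ?gt_eqF// powRr1// ltW.
pose c := (2 `^ lambda)^-1 / (4 * 2 ^+ M) : R.
have c0 : 0 < c by rewrite divr_gt0 ?invr_gt0 ?powR_gt0// mulr_gt0// exprn_gt0.
have ML0 : 0 <= M%:R * L by rewrite mulr_ge0// (ltW L0).
exists c, (2 + M%:R * L); split => [//||x hx]; first lra.
have r0 := half_space_enorm_gt0 hx.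
have hh : 0 < height x := hx.
have [e e1 be] := exists_unit_along (bproj x) m0.
set b := enorm (bproj x) in be.
have b0 : 0 <= b by exact: enorm_ge0.
have ee : dotp e e = 1 by rewrite -enorm_sqr e1 expr1n.
pose a := b + height x.
pose zt (j : nat) := a + j%:R * (L * enorm x).
have jL (j : nat) : 0 <= j%:R * (L * enorm x) by rewrite !mulr_ge0 ?(ltW L0) ?(ltW r0).
have ztE z : 0 <= z -> enorm (z *: e) = z.
  by move=> z0; rewrite enormZ e1 mulr1 ger0_norm.
have zt0 j : 0 <= zt j by rewrite /zt /a !addr_ge0// (ltW hh).
pose P := \poly_(k < M) (hgegen lambda k 1 (b / enorm x) / enorm x `^ (k%:R + 2 * lambda)).
have KE z : 0 <= z -> Kmod lambda M x (z *: e) =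
    ((z - b) ^+ 2 + height x ^+ 2) `^ (- lambda) - P.[z].
  move=> z0; rewrite KmodE// /K ztE//; congr (_ `^ _ - _).
    by rewrite {1}be -scalerBl enormZ e1 mulr1 real_normK ?num_real.
  rewrite horner_poly; apply: eq_bigr => k _.
  rewrite [RHS]mulrAC [_ * z ^+ k]mulrC -hgegen_scale mulr1; congr (hgegen _ _ _ _ / _).
  by rewrite {1}be dotpZl dotpZr ee; field; rewrite gt_eqF.
pose H := height x `^ (- (2 * lambda)).
have H0 : 0 < H by rewrite powR_gt0.
have [j jM Hj] : exists2 j, (j <= M)%N & c * H <= `|Kmod lambda M x (zt j *: e)|; last first.
  exists (zt j *: e); rewrite ztE//; split => //.
    rewrite (@le_trans _ _ a)//; last by rewrite /zt lerDl.
    rewrite -(@ler_pXn2r _ 2)// ?nnegrE ?enorm_ge0//; last by rewrite addr_ge0// (ltW hh).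
    by rewrite enorm_bproj -/b /a sqrrD addrAC lerDl mulrn_wge0// mulr_ge0// (ltW hh).
  rewrite /zt mulrDl mulrA lerD//.
    rewrite mulr_natl mulr2n lerD//; first exact: bproj_le_enorm.
    exact: height_le_enorm.
  by rewrite ler_pM2r// ler_pM2r// ler_nat.
apply: contrapT => Hn.
have {}Hn j : (j <= M)%N -> `|Kmod lambda M x (zt j *: e)| < c * H.
  by move=> jM; rewrite ltNge; apply/negP => ?; apply: Hn; exists j.
have LE z : 0 < z -> ((z * height x) ^+ 2) `^ (- lambda) = z `^ (- (2 * lambda)) * H.
  move=> z0; rewrite /H -powRM ?(ltW z0) ?(ltW hh)// -mulrN powRrM powR_mulrn//.
  by rewrite mulr_ge0 ?(ltW z0) ?(ltW hh).
have HB j : (0 < j <= M)%N -> `|P.[a + j%:R * (L * enorm x)]| <= (L `^ (- (2 * lambda)) + c) * H.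
  move=> /andP[j0 jM]; have := Hn j jM; rewrite KE// -/(zt j).
  set k := _ `^ _ => Hk.
  have : k <= L `^ (- (2 * lambda)) * H.
    rewrite -LE// /k !powRN lef_pV2 ?posrE ?powR_gt0 ?exprn_gt0 ?mulr_gt0//; last first.
      by rewrite ltr_wpDl ?sqr_ge0// exprn_gt0.
    apply: ge0_ler_powR; rewrite ?(ltW l0) ?nnegrE ?sqr_ge0// ?addr_ge0 ?sqr_ge0//.
    apply: (@le_trans _ _ ((zt j - b) ^+ 2)); last by rewrite lerDl sqr_ge0.
    have -> : zt j - b = height x + j%:R * (L * enorm x) by rewrite /zt /a; ring.
    rewrite lerXn2r ?nnegrE ?mulr_ge0 ?addr_ge0 ?(ltW hh) ?(ltW L0)//.
    apply: (@le_trans _ _ (1 * (L * enorm x))); last first.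
      rewrite ler_wpDl ?(ltW hh)// ler_wpM2r ?mulr_ge0 ?(ltW L0) ?(ltW r0)//.
      by rewrite ler1n.
    by rewrite mul1r ler_pM2l// height_le_enorm.
  have k0 : 0 <= k by exact: powR_ge0.
  move: Hk; rewrite distrC => Hk kL.
  have : `|P.[zt j]| <= `|P.[zt j] - k| + `|k|.
    by rewrite -{1}[P.[_]](subrK k) ler_normD.
  rewrite (ger0_norm k0) mulrDl; lra.
have := poly_extrapolation (size_poly _ _) HB.
have := Hn 0%N isT; rewrite KE// /zt mul0r addr0.
have -> : (a - b) ^+ 2 + height x ^+ 2 = (2 `^ 2^-1 * height x) ^+ 2.
  have s2 : (2 `^ 2^-1) ^+ 2 = 2 :> R.
    by rewrite -powR_mulrn ?powR_ge0// -powRrM mulVf// powRr1.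
  rewrite exprMn s2 /a; ring.
rewrite LE ?powR_gt0// -powRrM.
have -> : 2^-1 * - (2 * lambda) = - lambda by field.
rewrite !powRN LA.
have M0 : 0 < 2 ^+ M :> R by rewrite exprn_gt0.
have p0 : 0 < 2 `^ lambda :> R by rewrite powR_gt0.
rewrite /A /c; set Pa := P.[a]; set p := 2 `^ lambda in p0 *.
set u := 2 ^+ M in M0 *.
(* Both bounds are now multiples of p^-1 H, and they add up to less than it. *)
have -> : (u - 1) * (((4 * u * p)^-1 + p^-1 / (4 * u)) * H) = (1 - u^-1) * (p^-1 / 2 * H).
  by field; rewrite !gt_eqF.
have -> : p^-1 / (4 * u) * H = u^-1 * (p^-1 / 4 * H).
  by field; rewrite !gt_eqF.
have : 0 < p^-1 * H by rewrite mulr_gt0// invr_gt0.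
have : 0 < u^-1 by rewrite invr_gt0.
have : u^-1 <= 1 by rewrite invf_le1// exprn_ege1// ler1n.
move: (u^-1) (p^-1) => v q v1 v0 qH; rewrite ltr_norml ler_norml => /andP[_ H1] /andP[_ H2].
have vt : 0 < v * (q * H) by rewrite mulr_gt0.
lra.
Qed.
End LowerBound.

(** * Weighted integrals and the gliding hump *)
Section Gliding.
Context d (T : measurableType d) (R : realType) (mu : {measure set T -> \bar R}).

Lemma weighted_pairing (w k u : T -> R) (a : R) :
  measurable_fun setT w -> measurable_fun setT k -> measurable_fun setT u ->
  (forall y, `|k y| <= w y) -> (\int[mu]_y (`|u y| * w y)%:E <= a%:E)%E ->
  mu.-integrable setT (EFin \o (fun y => u y * k y)) /\ `|\int[mu]_y (u y * k y)| <= a.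
Proof.
move=> mw mk mut kw ua.
have muk : measurable_fun setT (fun y => u y * k y) by exact: measurable_funM.
have H : (\int[mu]_y `|(u y * k y)%:E| <= a%:E)%E.
  apply: le_trans ua; apply: ge0_le_integral => //.
  - by apply: measurableT_comp => //; exact/measurable_EFinP.
  - apply/measurable_EFinP/measurable_funM => //.
    exact: measurableT_comp.
  - move=> y _; rewrite abse_EFin lee_fin normrM ler_wpM2l//.
have ik : mu.-integrable setT (EFin \o (fun y => u y * k y)).
  apply/integrableP; split; first exact/measurable_EFinP.
  by apply: le_lt_trans H _; rewrite ltry.
split => //; apply: (le_trans (le_normr_Rintegral measurableT ik)).
rewrite -lee_fin fineK//.
rewrite ge0_fin_numE; last by apply: integral_ge0 => y _; rewrite lee_fin.
by apply: le_lt_trans H _; rewrite ltry.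
Qed.

Lemma le_integral_EFin (f1 f2 : T -> R) :
  measurable_fun setT f1 -> measurable_fun setT f2 ->
  (forall y, 0 <= f1 y) -> (forall y, f1 y <= f2 y) ->
  (\int[mu]_y (f1 y)%:E <= \int[mu]_y (f2 y)%:E)%E.
Proof.
move=> m1 m2 f10 f12; apply: ge0_le_integral => //; try exact/measurable_EFinP.
all: by move=> y _; rewrite lee_fin.
Qed.

Lemma integral_scale_EFin (a : R) (f : T -> R) :
  measurable_fun setT f -> 0 <= a -> (forall y, 0 <= f y) ->
  (\int[mu]_y (a * f y)%:E = a%:E * \int[mu]_y (f y)%:E)%E.
Proof.
move=> mf a0 f0; under eq_integral do rewrite EFinM.
rewrite ge0_integralZl_EFin//; first by move=> y _; rewrite lee_fin.
exact/measurable_EFinP.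
Qed.

Lemma integrable_mul_dominated (g k : T -> R) (B : R) :
  measurable_fun setT g -> measurable_fun setT k -> mu.-integrable setT (EFin \o g) ->
  (forall y, `|g y * k y| <= B * g y) -> mu.-integrable setT (EFin \o (fun y => g y * k y)).
Proof.
move=> mg mk ig gkB.
have H : mu.-integrable setT (fun y => (B%:E * (g y)%:E)%E) by exact: (integrableZl _ _ ig).
apply: le_integrable H => //; first by apply/measurable_EFinP/measurable_funM.
by move=> y _; rewrite /= lee_fin (le_trans (gkB y))// ler_norm.
Qed.

Variables (k g : nat -> T -> R) (w : T -> R) (c : R) (N : T -> nat).
Hypothesis c0 : 0 < c.
Hypothesis mk : forall j, measurable_fun setT (k j).
Hypothesis mg : forall j, measurable_fun setT (g j).
Hypothesis mw : measurable_fun setT w.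
Hypothesis g0 : forall j y, 0 <= g j y.
Hypothesis kw : forall j y, `|k j y| <= w y.
Hypothesis gw : forall j, (\int[mu]_y (g j y * w y)%:E <= 1)%E.
Hypothesis gk : forall j, c <= `|\int[mu]_y (g j y * k j y)|.
Hypothesis gN : forall y l, (N y <= l)%N -> g l y = 0.

(* With this ratio the tail of the series after a term is at most c/2 times that
   term, so that half of each hump survives. *)
Let q : R := c / (c + 2).

Let q0 : 0 < q.
Proof. by rewrite divr_gt0// addr_gt0. Qed.

Let q1 : q < 1.
Proof. by rewrite ltr_pdivrMr ?addr_gt0// mul1r ltrDl. Qed.

Let qc : q / (1 - q) = c / 2.
Proof.
have qE : q * (c + 2) = c by rewrite divfK// gt_eqF// addr_gt0.
apply/eqP; rewrite eqr_div ?pnatr_eq0// ?subr_eq0 ?(gt_eqF q1)//.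
apply/eqP; nra.
Qed.

(* The j-th hump gets the sign for which its pairing with k_j reinforces that of
   the earlier humps. *)
Let sgn_for (j : nat) (u : T -> R) : R :=
  if 0 <= (\int[mu]_y (u y * k j y)) * (\int[mu]_y (g j y * k j y)) then 1 else -1.

Fixpoint gliding_sum (j : nat) : T -> R :=
  if j is j'.+1 then
    fun y => gliding_sum j' y + sgn_for j' (gliding_sum j') * q ^+ j' * g j' y
  else fun=> 0.

Let s j := sgn_for j (gliding_sum j) * q ^+ j.
Let f y := gliding_sum (N y) y.

Let s_norm j : `|s j| = q ^+ j.
Proof.
rewrite normrM [`|q ^+ j|]ger0_norm ?exprn_ge0 ?(ltW q0)// /sgn_for.
by case: ifP; rewrite ?normrN normr1 mul1r.
Qed.

Let fsE j y : gliding_sum j y = \sum_(l < j) s l * g l y.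
Proof. by elim: j => [|j IH]; rewrite ?big_ord0// big_ord_recr /= IH. Qed.

Let fE j y : (N y <= j)%N -> f y = gliding_sum j y.
Proof.
move=> /subnKC <-; elim: (j - N y)%N => [|i IH]; first by rewrite addn0.
by rewrite addnS /= -IH gN ?leq_addr// mulr0 addr0.
Qed.

Let mfs j : measurable_fun setT (gliding_sum j).
Proof.
elim: j => [|j IH] /=; first exact: measurable_cst.
by apply: measurable_funD => //; apply: measurable_funM.
Qed.

Let mf : measurable_fun setT f.
Proof.
apply: (@measurable_fun_cvg _ _ _ _ gliding_sum) => // y _.
apply: cvg_near_cst; near=> j; apply/esym/fE; near: j; exact: nbhs_infty_ge.
Unshelve. all: by end_near. Qed.

Let w0 y : 0 <= w y. Proof. exact: le_trans (kw 0 y). Qed.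

Let tail_bound j y : ((`|f y - gliding_sum j y| * w y)%:E <=
  \sum_(0 <= l <oo) ((q ^+ (l + j))%:E * (g (l + j)%N y * w y)%:E))%E.
Proof.
have H0 l : (0 <= (q ^+ (l + j))%:E * (g (l + j)%N y * w y)%:E)%E.
  by rewrite -EFinM lee_fin !mulr_ge0// exprn_ge0// ltW.
have [jN|Nj] := leqP j (N y); last first.
  by rewrite (fE (ltnW Nj)) subrr normr0 mul0r; exact: nneseries_ge0.
apply: (@le_trans _ _ (\sum_(0 <= l < N y - j)
    ((q ^+ (l + j))%:E * (g (l + j)%N y * w y)%:E))%E); last first.
  by apply: nneseries_lim_ge.
under eq_bigr do rewrite -EFinM.
rewrite sumEFin lee_fin /f -{1}(subnK jN) big_mkord.
elim: (N y - j)%N => [|i IH].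
  by rewrite add0n subrr normr0 mul0r big_ord0.
rewrite addSn /= -/(s (i + j)) big_ord_recr /= addrAC.
apply: (@le_trans _ _ ((`|gliding_sum (i + j) y - gliding_sum j y|
    + `|s (i + j) * g (i + j)%N y|) * w y)).
  by rewrite ler_wpM2r// ler_normD.
by rewrite mulrDl lerD// normrM s_norm ger0_norm// mulrA.
Qed.

Let tail_int j : (\int[mu]_y (`|f y - gliding_sum j y| * w y)%:E <= (q ^+ j / (1 - q))%:E)%E.
Proof.
apply: (@le_trans _ _ (\int[mu]_y (\sum_(0 <= l <oo)
    ((q ^+ (l + j))%:E * (g (l + j)%N y * w y)%:E)))%E).
  apply: ge0_le_integral => //.
  - by move=> y _; rewrite lee_fin mulr_ge0.
  - apply/measurable_EFinP/measurable_funM => //.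
    by apply: measurableT_comp => //; exact: measurable_funB.
  - apply: ge0_emeasurable_sum => [l y _|l _].
      by rewrite -EFinM lee_fin !mulr_ge0// exprn_ge0// ltW.
    by apply: measurable_funeM; apply/measurable_EFinP/measurable_funM.
rewrite integral_nneseries//; last 2 first.
  - by move=> l; apply: measurable_funeM; apply/measurable_EFinP/measurable_funM.
  - by move=> l y _; rewrite -EFinM lee_fin !mulr_ge0// exprn_ge0// ltW.
have H0 l : (0 <= \int[mu]_y ((q ^+ (l + j))%:E * (g (l + j)%N y * w y)%:E))%E.
  by apply: integral_ge0 => y _; rewrite -EFinM lee_fin !mulr_ge0// exprn_ge0// ltW.
apply: lime_le; first exact: is_cvg_nneseries.
near=> n.
apply: (@le_trans _ _ (\sum_(0 <= l < n) (q ^+ (l + j))%:E)%E).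
  apply: lee_sum => l _; rewrite ge0_integralZl//.
  - rewrite -[leRHS]mule1; apply: lee_wpmul2l => //.
    by rewrite lee_fin exprn_ge0// ltW.
  - exact/measurable_EFinP/measurable_funM.
  - by move=> y _; rewrite lee_fin mulr_ge0.
  - by rewrite lee_fin exprn_ge0// ltW.
rewrite sumEFin lee_fin.
under eq_bigr do rewrite exprD.
rewrite -mulr_suml mulrC ler_wpM2l ?exprn_ge0 ?(ltW q0)//.
have q1' : 0 < 1 - q by rewrite subr_gt0.
rewrite -[leRHS]mul1r ler_pdivlMr// mulrC big_mkord -[1 - q]opprB mulNr -subrX1 opprB.
by rewrite gerBl exprn_ge0// ltW.
Unshelve. all: by end_near. Qed.

(** The absolute value of the pairing of k_j with the humps up to the j-th is at
    least c q^j by the choice of signs, and the later humps contribute at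
    most half of that.  The earlier humps need not be small. *)
Lemma gliding_hump : exists s : nat -> R,
  (\int[mu]_y (`|\sum_(l < N y) s l * g l y| * w y)%:E < +oo)%E /\
  forall j, c / 2 * (c / (c + 2)) ^+ j <= `|\int[mu]_y ((\sum_(l < N y) s l * g l y) * k j y)|.
Proof.
exists s; split.
  have := tail_int 0; rewrite /f => H; apply: le_lt_trans (ltry (q ^+ 0 / (1 - q))).
  apply: le_trans H; rewrite le_eqVlt; apply/orP; left; apply/eqP.
  by apply: eq_integral => y _; rewrite fsE subr0.
move=> j; rewrite -/q.
rewrite (_ : \int[mu]_y _ = \int[mu]_y (f y * k j y)); last first.
  by apply: eq_Rintegral => y _; rewrite /f fsE.
have ifk : mu.-integrable setT (EFin \o (fun y => f y * k j y)).
  have := tail_int 0 => /= H0.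
  have [] := @weighted_pairing w (k j) (fun y => f y - 0) _ mw (mk j) _ (kw j) H0.
    exact: measurable_funB.
  by move=> + _; apply: eq_integrable => // y _ /=; rewrite subr0.
have itail i : mu.-integrable setT (EFin \o (fun y => (f y - gliding_sum i y) * k j y)) /\
    `|\int[mu]_y ((f y - gliding_sum i y) * k j y)| <= q ^+ i / (1 - q).
  apply: (@weighted_pairing w (k j)) => //; exact: measurable_funB.
have ifs i : mu.-integrable setT (EFin \o (fun y => gliding_sum i y * k j y)).
  have := integrableB measurableT ifk (itail i).1; apply: eq_integrable => // y _ /=.
  by rewrite -EFinB -mulrBl subKr.
have igk : mu.-integrable setT (EFin \o (fun y => g j y * k j y)).
  have [] // := @weighted_pairing w (k j) (g j) 1 mw (mk j) (mg j) (kw j).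
  by under eq_integral do rewrite ger0_norm//; exact: gw.
have split_int : \int[mu]_y (f y * k j y) = \int[mu]_y (gliding_sum j.+1 y * k j y) +
    \int[mu]_y ((f y - gliding_sum j.+1 y) * k j y).
  rewrite -RintegralD//; last exact: (itail j.+1).1.
  by apply: eq_Rintegral => y _; rewrite -mulrDl addrC subrK.
have main : \int[mu]_y (gliding_sum j.+1 y * k j y) =
   \int[mu]_y (gliding_sum j y * k j y) + s j * \int[mu]_y (g j y * k j y).
  rewrite -RintegralZl// -RintegralD//; last first.
    by have := integrableZl measurableT (s j) igk; apply: eq_integrable.
  by apply: eq_Rintegral => y _ /=; rewrite mulrDl -/(s j) mulrA.
have ge : q ^+ j * c <= `|\int[mu]_y (gliding_sum j.+1 y * k j y)|.
  rewrite main; have := gk j; rewrite /s /sgn_for.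
  set A := \int[mu]_y (gliding_sum j y * _); set B := \int[mu]_y (g j y * _) => cB.
  have qj : 0 < q ^+ j by rewrite exprn_gt0.
  apply: (@le_trans _ _ (q ^+ j * `|B|)); first by rewrite ler_pM2l.
  have -> : q ^+ j * `|B| = `|q ^+ j * B| by rewrite normrM (gtr0_norm qj).
  rewrite -ler_sqr ?nnegrE// !real_normK ?num_real//.
  have [AB|/ltW AB] := leP 0 (A * B); nra.
rewrite split_int; have [_ tl] := itail j.+1.
have tE : q ^+ j.+1 / (1 - q) = q ^+ j * (c / 2) by rewrite exprSr -mulrA qc.
rewrite tE in tl.
set X := \int[mu]_y _ in ge *; set Y := \int[mu]_y _ in tl *.
have : `|X| <= `|X + Y| + `|Y| by rewrite -{1}(addrK Y X) ler_normB.
lra.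
Qed.

End Gliding.

(** * Continuity and Lebesgue measurability on row vectors *)
Section ContinuousReal.
Context {R : realType} {V : topologicalType}.

Lemma continuous_sum_fun (I : Type) (s : seq I) (F : I -> V -> R) :
  (forall i, continuous (F i)) -> continuous (fun v => \sum_(i <- s) F i v).
Proof.
move=> cF; elim: s => [|i s IH].
  by under eq_fun do rewrite big_nil; exact: cst_continuous.
under eq_fun do rewrite big_cons.
by move=> v; apply: cvgD; [exact: cF|exact: IH].
Qed.

Lemma continuous_sub_fun (f g : V -> R) : continuous f -> continuous g ->
  continuous (fun v => f v - g v).
Proof. by move=> cf cg v; apply: cvgB; [exact: cf|exact: cg]. Qed.

Lemma continuous_mul_fun (f g : V -> R) : continuous f -> continuous g ->
  continuous (fun v => f v * g v).
Proof. by move=> cf cg v; apply: cvgM; [exact: cf|exact: cg]. Qed.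

Lemma continuous_exp_fun (f : V -> R) n : continuous f -> continuous (fun v => f v ^+ n).
Proof.
move=> cf; elim: n => [|n IH]; first by under eq_fun do rewrite expr0; exact: cst_continuous.
by under eq_fun do rewrite exprS; exact: continuous_mul_fun.
Qed.

Lemma continuous_powR_fun (f : V -> R) p : continuous f -> (forall v, 0 < f v) ->
  continuous (fun v => f v `^ p).
Proof.
move=> cf f0 v; apply: (@continuous_comp _ _ _ f (fun x => x `^ p)); first exact: cf.
apply: differentiable_continuous; apply/derivable1_diffP.
by have [] := is_derive1_powR p (f0 v).
Qed.

Lemma continuous_hgegen lambda k (u t : V -> R) : continuous u -> continuous t ->
  continuous (fun v => hgegen lambda k (u v) (t v)).
Proof.
move=> cu ct; elim/nat_ind2: k => [||k IH1 IH2].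
- by rewrite /hgegen /=; exact: cst_continuous.
- by rewrite /hgegen /=; apply: continuous_mul_fun => //; exact: cst_continuous.
rewrite (_ : (fun _ => _) = (fun v =>
  (2 * (k.+1%:R + lambda) * t v * hgegen lambda k.+1 (u v) (t v)
   + - (k%:R + 2 * lambda) * u v * hgegen lambda k (u v) (t v)) * k.+2%:R^-1)); last first.
  by apply/funext => v; rewrite !mulNr -hgegen_rec mulrC mulKf// pnatr_eq0.
have cc (a : R) : continuous (fun _ : V => a) by exact: cst_continuous.
apply: continuous_mul_fun => // v; apply: cvgD; move: v.
  by do !apply: continuous_mul_fun => //.
by do !apply: continuous_mul_fun => //.
Qed.

End ContinuousReal.

Section ContinuousRV.
Context {R : realType} {m : nat}.
Local Notation V := 'rV[R]_m.
Local Notation mu := (@completed_lebesgue_rV R m).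

Lemma lebesgue_rV_measurable (A : set V) : measurable A ->
  measurable (A : set (lebesgue_rV_type m)).
Proof. by move=> mA; apply: sub_caratheodory; exact: sub_sigma_algebra. Qed.

(** Cubes are both balls of the sup norm, which defines the topology, and boxes,
    whose Lebesgue measure is known. *)
Definition cube (c : V) (d : R) : set V :=
  [set v | forall i, `]c ord0 i - d, c ord0 i + d[%classic (v ord0 i)].

Lemma measurable_cube c d : measurable (cube c d).
Proof.
rewrite (_ : cube c d = \big[setI/setT]_(i < m)
    ((fun v : V => v ord0 i : measurableTypeR R) @^-1` `]c ord0 i - d, c ord0 i + d[%classic)).
  apply: bigsetI_measurable => i _.
  by rewrite -[X in measurable X]setTI; apply: measurable_coor => //; exact: measurable_itv.
rewrite -bigcap_seq; apply/seteqP; split => [v Bv i _|v Bv i]; first exact: Bv.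
by apply: (Bv i); rewrite /= mem_index_enum.
Qed.

Lemma lebesgue_cube c d : 0 < d -> mu (cube c d) = ((2 * d) ^+ m)%:E.
Proof.
move=> d0; rewrite /completed_lebesgue_rV /completed_measure_extension.
rewrite measurable_mu_extE; last exact: measurable_cube.
apply: (etrans (@lebesgue_rV_box R m (fun i => `]c ord0 i - d, c ord0 i + d[%classic) _)).
  by move=> i; exact: measurable_itv.
rewrite (eq_bigr (fun=> (2 * d)%:E)) => [|i _]; last first.
  rewrite lebesgue_measure_itv /= lte_fin ifT -?EFinD; last lra.
  by congr EFin; ring.
by rewrite prodEFin prodr_const card_ord.
Qed.

(** Second countability: rational cubes contained in O cover it. *)
Lemma open_measurable_rV (O : set V) : open O -> measurable O.
Proof.
move=> oO.
pose B (p : 'rV[rat]_m * nat) := cube (map_mx ratr p.1) p.2.+1%:R^-1.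
rewrite (_ : O = \bigcup_(p in [set p | B p `<=` O]) B p).
  rewrite bigcup_mkcond; apply: countable_bigcupT_measurable => [|p]; first exact: countableP.
  by case: ifPn => // _; exact: measurable_cube.
apply/seteqP; split => [v Ov|v [p /= BO] Bv]; last exact: BO.
have /nbhs_ballP[e /= e0 eO] := oO v Ov.
have [k ke] : exists k : nat, 2 * k.+1%:R^-1 < e.
  exists (Num.trunc (2 / e)).
  rewrite -ltr_pdivlMl// -[ltRHS]invrK ltf_pV2 ?posrE ?invr_gt0 ?mulr_gt0 ?invr_gt0//.
  by rewrite invfM invrK mulrC; apply: truncnS_gt.
have k0 : 0 < k.+1%:R^-1 :> R by rewrite invr_gt0.
have [dk dkE] : exists d : R, d = k.+1%:R^-1 by exists k.+1%:R^-1.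
rewrite -dkE in ke k0.
have /choice[q Hq] : forall i, exists q : rat, ratr q \in `](v ord0 i - dk), (v ord0 i + dk)[.
  by move=> i; apply: rat_in_itvoo; lra.
exists (\row_i q i, k) => [w|i /=]; rewrite /B /= -dkE; last first.
  have := Hq i; rewrite !mxE !in_itv /= => /andP[? ?]; apply/andP; split; lra.
move=> Bw; apply: eO; split => // i j; rewrite ord1.
have := Hq j; have := Bw j; rewrite /= !mxE !in_itv /= => /andP[? ?] /andP[? ?].
by rewrite /ball /= ltr_norml; apply/andP; split; lra.
Qed.

Lemma continuous_lebesgue_measurable (f : V -> R) : continuous f -> lebesgue_measurable_fun f.
Proof.
move=> /continuousP cf; apply: (measurability _ (RGenOpens.measurableE R)).
move=> _ [_ [a [b ->] <-]]; rewrite setTI; apply: lebesgue_rV_measurable.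
by apply: open_measurable_rV; exact/cf/interval_open.
Qed.

Lemma continuous_dotp (a : V) : continuous (dotp a).
Proof.
apply: continuous_sum_fun => i; apply: continuous_mul_fun; first exact: cst_continuous.
exact: coord_continuous.
Qed.

Lemma continuous_enorm_sub (a : V) : continuous (fun v : V => enorm (v - a)).
Proof.
have cd : continuous (fun v : V => dotp (v - a) (v - a)).
  rewrite (_ : (fun _ => _) = (fun v : V => \sum_i (v ord0 i - a ord0 i) ^+ 2)); last first.
    by apply/funext => v; apply: eq_bigr => i _; rewrite !mxE expr2.
  apply: continuous_sum_fun => i; apply: continuous_exp_fun; apply: continuous_sub_fun.
    exact: coord_continuous.
  exact: cst_continuous.
move=> v; apply: (@continuous_comp _ _ _
  (fun v : 'rV[R]_m => dotp (v - a : 'rV[R]_m) (v - a)) Num.sqrt v).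
  exact: cd.
exact: sqrt_continuous.
Qed.

Lemma continuous_enorm : continuous (@enorm R m).
Proof.
rewrite (_ : @enorm R m = (fun v : V => enorm (v - 0))); first exact: continuous_enorm_sub.
by apply/funext => v; rewrite subr0.
Qed.

Lemma continuous_weight M : continuous (fun y : V => enorm y ^+ M + 1).
Proof.
under eq_fun do rewrite -[1]opprK.
apply: continuous_sub_fun; last exact: cst_continuous.
exact/continuous_exp_fun/continuous_enorm.
Qed.

Lemma continuous_Kmod lambda M (x : 'rV[R]_m.+1) : 0 < lambda -> half_space x ->
  continuous (Kmod lambda M x).
Proof.
move=> l0 hx.
rewrite (_ : Kmod lambda M x = (fun y => K lambda x y -
  \sum_(k < M) hgegen lambda k (enorm y ^+ 2) (dotp (bproj x) y / enorm x)
    / enorm x `^ (k%:R + 2 * lambda))); last by apply/funext => y; exact: KmodE.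
have cc (a : R) : continuous (fun _ : V => a) by exact: cst_continuous.
apply: continuous_sub_fun.
  apply: continuous_powR_fun => [|v]; last by rewrite ltr_wpDl ?sqr_ge0// exprn_gt0.
  under eq_fun do rewrite -[height x ^+ 2]opprK.
  apply: continuous_sub_fun => //.
  apply: continuous_exp_fun. exact: continuous_enorm_sub.
apply: continuous_sum_fun => k; apply: continuous_mul_fun => //.
apply: continuous_hgegen; first exact: (continuous_exp_fun continuous_enorm).
by apply: continuous_mul_fun => //; exact: continuous_dotp.
Qed.

End ContinuousRV.

(** * Bumps and truncated moments *)
Section Bump.
Context {R : realType} {m : nat}.
Local Notation V := 'rV[R]_m.
Local Notation mu := (@completed_lebesgue_rV R m).

(** A normalised tent.  Its integral is finite because the support lies in a cube and
    positive because the tent is at least 1/2 on a smaller cube. *)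
Lemma bump_function (y0 : V) (d : R) : 0 < d -> exists g : V -> R,
  [/\ continuous g, forall y, 0 <= g y, forall y, d <= enorm (y - y0) -> g y = 0 &
      (\int[mu]_y (g y)%:E = 1)%E].
Proof.
move=> d0; pose phi (y : V) : R := Num.max 0 (1 - enorm (y - y0) / d).
have cphi : continuous phi.
  move=> y; apply: (@continuous_max R _ (fun=> 0) (fun y : V => 1 - enorm (y - y0) / d)).
    exact: cst_continuous.
  apply: continuous_sub_fun; first exact: cst_continuous.
  apply: continuous_mul_fun; last exact: cst_continuous.
  exact: continuous_enorm_sub.
have phi0 y : 0 <= phi y by rewrite /phi le_max lexx.
have mphi : lebesgue_measurable_fun phi by exact: continuous_lebesgue_measurable.
have phiz y : d <= enorm (y - y0) -> phi y = 0.
  by move=> dy; rewrite /phi max_l// subr_le0 ler_pdivlMr// mul1r.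
have mcube (c : V) (e : R) : measurable (cube c e : set (lebesgue_rV_type m)).
  by apply: lebesgue_rV_measurable; exact: measurable_cube.
have cubeE (c : V) (e : R) : 0 < e -> (\int[mu]_y (\1_(cube c e) y)%:E = ((2 * e) ^+ m)%:E)%E.
  by move=> e0; rewrite integral_indic// setIT; exact: lebesgue_cube.
pose I := (\int[mu]_y (phi y)%:E)%E.
have mind (c : V) (e : R) : measurable_fun [set: lebesgue_rV_type m] (\1_(cube c e) : _ -> R).
  by apply: measurable_indic; exact: mcube.
have Ioo : (I < +oo)%E.
  apply: (@le_lt_trans _ _ (\int[mu]_y (\1_(cube y0 d) y)%:E)%E).
    apply: le_integral_EFin; [exact: mphi|exact: mind|exact: phi0|move=> y; rewrite indicE].
    have [yd|yd] := leP d (enorm (y - y0)); first by rewrite phiz.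
    rewrite mem_set /=.
      by rewrite /phi ge_max ler01 /= lerBlDr lerDl divr_ge0 ?enorm_ge0// ltW.
    move=> i; rewrite /= in_itv /=.
    have := le_lt_trans (ler_coord_enorm (y - y0) i) yd.
    by rewrite !mxE ltr_norml => /andP[? ?]; apply/andP; split; lra.
  by rewrite cubeE// ltry.
have I0 : (0 < I)%E.
  pose e := d / (2 * m.+1%:R).
  have e0 : 0 < e by rewrite divr_gt0// mulr_gt0.
  have h0 : 0 <= 2^-1 :> R by rewrite invr_ge0.
  have ind0 y : 0 <= \1_(cube y0 e) y :> R by rewrite indicE.
  apply: (@lt_le_trans _ _ (\int[mu]_y (2^-1 * \1_(cube y0 e) y)%:E)%E).
    rewrite (integral_scale_EFin mu (mind y0 e) h0 ind0) cubeE// -EFinM lte_fin.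
    by rewrite mulr_gt0// exprn_gt0// mulr_gt0.
  have mh : measurable_fun [set: lebesgue_rV_type m] (fun y => 2^-1 * \1_(cube y0 e) y : R).
    exact: measurable_funM (measurable_cst _) (mind y0 e).
  have hind0 y : 0 <= 2^-1 * \1_(cube y0 e) y :> R by rewrite mulr_ge0.
  apply: (le_integral_EFin mu mh mphi hind0) => y; rewrite indicE.
  have [|_] := boolP (y \in cube y0 e); last by rewrite mulr0.
  rewrite inE mulr1 => yc.
  have : enorm (y - y0) <= d / 2.
    apply: (le_trans (enorm_le_sum _)).
    apply: (@le_trans _ _ (\sum_(i < m) e)).
      apply: ler_sum => i _; have := yc i; rewrite /= in_itv /= !mxE => /andP[? ?].
      by rewrite ler_norml; apply/andP; split; lra.
    rewrite sumr_const card_ord -[e *+ m]mulr_natl.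
    apply: (@le_trans _ _ (m.+1%:R * e)); first by rewrite ler_pM2r// ler_nat.
    by rewrite le_eqVlt /e; apply/orP; left; apply/eqP; field.
  move=> yd; rewrite /phi le_max; apply/orP; right.
  have : enorm (y - y0) / d <= 2^-1 by rewrite ler_pdivrMr// mulrC.
  lra.
have If : I \is a fin_num by rewrite ge0_fin_numE// ltW.
have i0 : 0 < fine I by rewrite fine_gt0// I0.
exists (fun y => (fine I)^-1 * phi y); split.
- apply: continuous_mul_fun => //; exact: cst_continuous.
- by move=> y; rewrite mulr_ge0// invr_ge0 ltW.
- by move=> y yd; rewrite phiz// mulr0.
have i0' : 0 <= (fine I)^-1 by rewrite invr_ge0 ltW.
rewrite (integral_scale_EFin mu mphi i0' phi0).
by rewrite -/I -[X in (_ * X)%E](fineK If) -EFinM mulVf// gt_eqF.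
Qed.

Lemma nbhs_enorm_ball (y0 : V) (A : set V) : nbhs y0 A ->
  exists2 d, 0 < d & forall y, enorm (y - y0) < d -> A y.
Proof.
move=> /nbhs_ballP[e /= e0 eA]; exists e => // y ye; apply: eA; split => // i j.
rewrite ord1 /ball /= distrC; apply: le_lt_trans ye.
by have := ler_coord_enorm (y - y0) j; rewrite !mxE.
Qed.

(** On a small ball around y0 the function k keeps its sign and at least
    half of the size it has at y0. *)
Lemma bump_pairing (k : V -> R) (y0 : V) (c : R) :
  continuous k -> 0 < c -> c <= `|k y0| ->
  exists g : V -> R, [/\ continuous g, forall y, 0 <= g y,
      forall y, 1 <= `|enorm y - enorm y0| -> g y = 0,
      (\int[mu]_y (g y)%:E = 1)%E &
      mu.-integrable setT (EFin \o (fun y => g y * k y)) /\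
      c / 2 <= `|\int[mu]_y (g y * k y)|].
Proof.
move=> ck c0 kc.
have [d d0 Hd] : exists2 d, 0 < d & forall y, enorm (y - y0) < d -> `|k y0 - k y| < c / 2.
  apply: nbhs_enorm_ball; have := ck y0; move=> /cvgrPdist_lt; apply.
  by rewrite divr_gt0.
pose d' := Num.min d 1.
have d'0 : 0 < d' by rewrite lt_min d0 ltr01.
have [g [cg g0 gz g1]] := bump_function y0 d'0.
exists g; split => // [y y1|].
  apply: gz; rewrite ge_min; apply/orP; right.
  exact: le_trans y1 (ler_enormB _ _).
have mg : lebesgue_measurable_fun g by exact: continuous_lebesgue_measurable.
have mk : lebesgue_measurable_fun k by exact: continuous_lebesgue_measurable.
have gk y : g y != 0 -> `|k y0 - k y| < c / 2.
  move=> gy; apply: Hd; rewrite ltNge; apply: contra gy => dy.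
  by rewrite gz// (le_trans _ dy)// ge_min lexx.
have ig : mu.-integrable setT (EFin \o g).
  apply/integrableP; split; first exact/measurable_EFinP.
  under eq_integral do rewrite /= ger0_norm//.
  by rewrite g1 ltry.
pose s : R := if 0 <= k y0 then 1 else -1.
have sk : `|k y0| = s * k y0.
  by rewrite /s; case: leP => H; [rewrite mul1r ger0_norm|rewrite mulN1r ltr0_norm].
have s1 : `|s| = 1 by rewrite /s; case: ifP; rewrite ?normrN normr1.
have igk : mu.-integrable setT (EFin \o (fun y => g y * k y)).
  apply: (integrable_mul_dominated (B := `|k y0| + c / 2) mg mk ig) => y.
  rewrite normrM [`|g y|]ger0_norm// mulrC.
  have [->|/gk kk] := eqVneq (g y) 0; first by rewrite !mulr0.
  apply: ler_wpM2r => //.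
  have : `|k y| <= `|k y0| + `|k y0 - k y| by rewrite -{1}(subKr (k y0) (k y)) ler_normB.
  lra.
split=> //.
have -> : `|\int[mu]_y (g y * k y)| = `|\int[mu]_y (s * (g y * k y))|.
  by rewrite RintegralZl// normrM s1 mul1r.
apply: le_trans (ler_norm _).
have -> : c / 2 = \int[mu]_y (c / 2 * g y).
  by rewrite RintegralZl// /Rintegral g1 /= mulr1.
apply: le_Rintegral => //.
- exact: (integrableZl _ _ ig).
- exact: (integrableZl _ _ igk).
move=> y _; have [->|/gk] := eqVneq (g y) 0; first by rewrite mul0r !mulr0.
rewrite [s * _]mulrCA [c / 2 * _]mulrC => kk; apply: ler_wpM2l => //.
have : s * (k y0 - k y) <= c / 2.
  by apply: (le_trans (ler_norm _)); rewrite normrM s1 mul1r ltW.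
rewrite mulrBr -sk; lra.
Qed.

End Bump.

Section Decay.
Context d (T : measurableType d) (R : realType) (mu : {measure set T -> \bar R}).

Lemma measurable_truncated_power (N : T -> R) M (r : R) : measurable_fun setT N ->
  measurable_fun setT (fun y => N y ^+ M * Num.min 1 `|N y / r|).
Proof.
move=> mN; apply: measurable_funM; first exact: measurable_funX.
apply: measurable_minr => //; apply: measurableT_comp => //.
exact: measurable_funM.
Qed.

(** The truncation tends to 0 pointwise and never exceeds 1. *)
Lemma truncated_moment_cvg0 (f N : T -> R) M :
  measurable_fun setT f -> measurable_fun setT N -> (forall y, 0 <= N y) ->
  (\int[mu]_y (`|f y| * (N y ^+ M + 1))%:E < +oo)%E ->
  (\int[mu]_y (`|f y| * (N y ^+ M * Num.min 1 `|N y / r|))%:E)%E @[r --> +oo] --> 0%E.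
Proof.
move=> mf mN N0 foo; apply/cvge_pinftyP => u uoo.
have mF r : measurable_fun setT (fun y => (`|f y| * (N y ^+ M * Num.min 1 `|N y / r|))%:E).
  apply/measurable_EFinP/measurable_funM; first exact: measurableT_comp.
  exact: measurable_truncated_power.
have min0 y r : 0 <= Num.min 1 `|N y / r| by rewrite le_min ler01 normr_ge0.
have ig : mu.-integrable setT (fun y => (`|f y| * (N y ^+ M + 1))%:E).
  apply/integrableP; split.
    apply/measurable_EFinP/measurable_funM; first exact: measurableT_comp.
    by apply: measurable_funD => //; exact: measurable_funX.
  under eq_integral do rewrite abse_EFin ger0_norm ?mulr_ge0 ?addr_ge0 ?exprn_ge0//.
  exact: foo.
have [] := @dominated_convergence _ _ _ mu setT measurableT
  (fun n y => (`|f y| * (N y ^+ M * Num.min 1 `|N y / u n|))%:E) (cst 0%E)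
  (fun y => (`|f y| * (N y ^+ M + 1))%:E) (fun n => mF (u n)) _ _ ig.
- exact: measurable_cst.
- apply: aeW => y _; rewrite /cst; apply: cvg_EFin; first by near=> n.
  rewrite [X in _ --> X](_ : 0 = `|f y| * (N y ^+ M * Num.min 1 `|N y * 0|)); last first.
    by rewrite mulr0 normr0 min_r// !mulr0.
  apply: cvgMr; apply: cvgMr.
  have cm : continuous (fun t : R => Num.min 1 `|t|).
    move=> t; apply: (@continuous_min R R (fun=> 1) (fun t => `|t|)); first exact: cst_continuous.
    exact: norm_continuous.
  apply: (@continuous_cvg _ _ _ _ _ (fun n => N y / u n) _ _ (cm (N y * 0))).
  by apply: cvgMr; apply/gtr0_cvgV0 => //; move/cvgryPgt: uoo => /(_ 0).
- apply: aeW => y n _; rewrite abse_EFin lee_fin ger0_norm ?mulr_ge0 ?exprn_ge0//.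
  rewrite ler_wpM2l// (@le_trans _ _ (N y ^+ M))// ?lerDl//.
  by rewrite ler_piMr ?exprn_ge0// ge_min lexx.
by move=> _ _; rewrite integral0.
Unshelve. all: by end_near. Qed.

Lemma truncated_pairing (f N k : T -> R) M (r a : R) :
  measurable_fun setT f -> measurable_fun setT N -> measurable_fun setT k ->
  (forall y, 0 <= N y) -> 0 <= a ->
  (\int[mu]_y (`|f y| * (N y ^+ M + 1))%:E < +oo)%E ->
  (forall y, `|k y| <= a * (N y ^+ M * Num.min 1 `|N y / r|)) ->
  (`|\int[mu]_y (f y * k y)|%:E <=
    a%:E * \int[mu]_y (`|f y| * (N y ^+ M * Num.min 1 `|N y / r|))%:E)%E.
Proof.
move=> mf mN mk N0 a0 foo kw; set I := (\int[mu]_y _)%E.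
have mw := measurable_truncated_power M r mN.
have mfw : measurable_fun setT (fun y => (`|f y| * (N y ^+ M * Num.min 1 `|N y / r|))%:E).
  by apply/measurable_EFinP/measurable_funM => //; exact: measurableT_comp.
have w0 y : 0 <= N y ^+ M * Num.min 1 `|N y / r|.
  by rewrite mulr_ge0 ?exprn_ge0// le_min ler01 normr_ge0.
have If : I \is a fin_num.
  rewrite ge0_fin_numE; last by apply: integral_ge0 => y _; rewrite lee_fin mulr_ge0.
  apply: le_lt_trans foo; apply: ge0_le_integral => //.
  - by move=> y _; rewrite lee_fin mulr_ge0.
  - apply/measurable_EFinP/measurable_funM; first exact: measurableT_comp.
    by apply: measurable_funD => //; exact: measurable_funX.
  move=> y _; rewrite lee_fin ler_wpM2l// (@le_trans _ _ (N y ^+ M))// ?lerDl//.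
  by rewrite ler_piMr ?exprn_ge0// ge_min lexx.
rewrite -(fineK If) -EFinM lee_fin.
apply: (@weighted_pairing _ _ _ mu
  (fun y => a * (N y ^+ M * Num.min 1 `|N y / r|)) k f _ _ mk mf kw _).2.
  by apply: measurable_funM.
under eq_integral do rewrite mulrCA EFinM.
rewrite ge0_integralZl_EFin//; last by move=> y _; rewrite lee_fin mulr_ge0.
by rewrite -/I EFinM fineK.
Qed.

End Decay.

(** * The estimate and its sharpness *)
Section Main.
Context {R : realType} {m : nat}.
Local Notation V := 'rV[R]_m.
Local Notation mu := (@completed_lebesgue_rV R m).
Variable lambda : R.
Hypothesis l0 : 0 < lambda.
Variable M : nat.
Local Notation weight := (fun y : V => enorm y ^+ M + 1).

Let menorm : lebesgue_measurable_fun (@enorm R m).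
Proof. exact/continuous_lebesgue_measurable/continuous_enorm. Qed.

Let mKmod (x : 'rV[R]_m.+1) : half_space x -> lebesgue_measurable_fun (Kmod lambda M.+1 x).
Proof. by move=> hx; exact/continuous_lebesgue_measurable/continuous_Kmod. Qed.

Let weight0 (y : V) : 0 <= weight y.
Proof. by rewrite addr_ge0// exprn_ge0// enorm_ge0. Qed.

Lemma exists_half_space_enorm (r : R) : 0 < r ->
  exists2 x : 'rV[R]_m.+1, half_space x & enorm x = r.
Proof.
move=> r0; have e1 : enorm (delta_mx ord0 ord_max : 'rV[R]_m.+1) = 1.
  rewrite /enorm /dotp (bigD1 ord_max)//= big1 => [|i i0].
    by rewrite addr0 !mxE !eqxx mulr1 sqrtr1.
  by rewrite !mxE (negbTE i0) andbF mulr0.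
exists (r *: delta_mx ord0 ord_max); last by rewrite enormZ e1 mulr1 gtr0_norm.
by rewrite /half_space /height /= !mxE !eqxx mulr1.
Qed.

(** The supremum over the half sphere of radius r is squeezed between 0 and a
    multiple of the truncated moment; that the half sphere is nonempty matters,
    as the supremum of the empty set is -oo. *)
Lemma Fmod_little_o (f : V -> R) : lebesgue_measurable_fun f ->
  moment_finite M.+1 f -> little_o (Fmod lambda M.+1 f) (growth lambda M.+1).
Proof.
move=> mf foo; have [C C0 HC] := @Kmod_bound R m lambda l0 M.
pose I r := (\int[mu]_y (`|f y| * (enorm y ^+ M * Num.min 1 `|enorm y / r|))%:E)%E.
have I_cvg : I r @[r --> +oo] --> 0%E.
  by apply: truncated_moment_cvg0 => //; exact: enorm_ge0.
have key x : half_space x ->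
    ((`|Fmod lambda M.+1 f x| / growth lambda M.+1 x)%:E <= C%:E * I (enorm x))%E.
  move=> hx; have r0 := half_space_enorm_gt0 hx.
  have w0 := growth_gt0 lambda M hx.
  have Cw : 0 <= C * growth lambda M.+1 x by rewrite mulr_ge0 ?(ltW C0) ?(ltW w0).
  rewrite EFinM lee_pdivrMr// muleC muleA -EFinM [_ * C]mulrC.
  apply: (truncated_pairing mf menorm (mKmod hx) (@enorm_ge0 _ _) Cw foo) => y.
  by rewrite [`|_ / _|]ger0_norm ?divr_ge0 ?enorm_ge0//; exact: HC.
apply: (@squeeze_cvge _ _ _ _ (fun=> 0%E) _ (fun r => C%:E * I r)%E).
- near=> r; have r0 : 0 < r by near: r; exact: nbhs_pinfty_gt.
  apply/andP; split.
    have [x hx xr] := exists_half_space_enorm r0.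
    apply: (@le_trans _ _ (`|Fmod lambda M.+1 f x| / growth lambda M.+1 x)%:E).
      by rewrite lee_fin divr_ge0// ltW// growth_gt0.
    by apply: ereal_sup_ubound; exists x.
  by apply: ub_ereal_sup => _ [x [hx <-] <-]; exact: key.
- exact: cvg_cst.
- rewrite -[X in _ --> X](mule0 C%:E); exact: cvgeZl.
Unshelve. all: by end_near. Qed.

(** Division by C growth(x) makes the kernels dominated by one weight, as the gliding
    hump requires.  The bump sits where [Kmod_lower] says that the kernel is large;
    since |y| is comparable to |x| there, its weighted mass is comparable to
    |x|^M, which is exactly the factor between h^(-2 lambda) and growth(x). *)
Lemma normalized_bump : (0 < m)%N -> exists C c : R, [/\ 0 < C, 0 < c &
  forall x, half_space x -> 1 <= enorm x ->
    (forall y, `|Kmod lambda M.+1 x y / (C * growth lambda M.+1 x)| <= weight y) /\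
    exists g : V -> R, [/\ continuous g, forall y, 0 <= g y,
      forall y, enorm y <= enorm x - 1 -> g y = 0,
      (\int[mu]_y (g y * weight y)%:E <= 1)%E &
      c <= `|\int[mu]_y (g y * (Kmod lambda M.+1 x y / (C * growth lambda M.+1 x)))| ]].
Proof.
move=> m0; have [C C0 HC] := @Kmod_bound R m lambda l0 M.
have [c1 [C1 [c10 C11 HL]]] := Kmod_lower l0 m0 M.+1.
pose W := (C1 + 1) ^+ M + 1.
have W0 : 0 < W by rewrite ltr_wpDl// exprn_ge0// addr_ge0//; lra.
exists C, (c1 / (2 * W * C)); split => [//||x hx x1].
  by rewrite divr_gt0// !mulr_gt0.
have r0 := half_space_enorm_gt0 hx.
have w0 := growth_gt0 lambda M hx.
have Cw : 0 < C * growth lambda M.+1 x by rewrite mulr_gt0.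
split => [y|].
  rewrite normrM normfV [`|C * _|]gtr0_norm// ler_pdivrMr// mulrC.
  apply: (le_trans (HC x y hx)); rewrite ler_pM2l//.
  rewrite (@le_trans _ _ (enorm y ^+ M))// ?lerDl//.
  by rewrite ler_piMr ?exprn_ge0 ?enorm_ge0// ge_min lexx.
have [y0 [y0r y0C Hy0]] := HL x hx.
have rM : 0 < enorm x ^+ M by rewrite exprn_gt0.
have hE : height x `^ (- (2 * lambda)) = growth lambda M.+1 x * enorm x ^+ M.
  by rewrite growthE// divfK// gt_eqF.
rewrite hE in Hy0.
have c0 : 0 < c1 * (growth lambda M.+1 x * enorm x ^+ M) by rewrite mulr_gt0// mulr_gt0.
have ck : continuous (Kmod lambda M.+1 x) by exact: continuous_Kmod.
have [g [cg g0 gz g1 [igk gk]]] := bump_pairing ck c0 Hy0.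
have mg : lebesgue_measurable_fun g by exact: continuous_lebesgue_measurable.
pose a := (W * enorm x ^+ M)^-1.
have a0 : 0 < a by rewrite invr_gt0 mulr_gt0.
exists (fun y => a * g y); split.
- apply: continuous_mul_fun => //; exact: cst_continuous.
- by move=> y; rewrite mulr_ge0// ltW.
- move=> y yx; rewrite gz ?mulr0// distrC; apply: le_trans (ler_norm _); lra.
- have -> : 1%E = (\int[mu]_y (g y)%:E)%E by rewrite g1.
  have mgw : lebesgue_measurable_fun (fun y : V => a * g y * weight y).
    apply: continuous_lebesgue_measurable; apply: continuous_mul_fun.
      by apply: continuous_mul_fun => //; exact: cst_continuous.
    exact: continuous_weight.
  have gw0 y : 0 <= a * g y * weight y by rewrite !mulr_ge0 ?(ltW a0) ?weight0.
  apply: (le_integral_EFin mu mgw mg gw0) => y.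
  have [y1|y1] := leP 1 `|enorm y - enorm y0|; first by rewrite gz// mulr0 mul0r.
  rewrite -mulrA mulrCA -[leRHS]mulr1; apply: ler_wpM2l => //.
  rewrite /a mulrC ler_pdivrMr ?mulr_gt0// mul1r /W mulrDl mul1r; apply: lerD.
    rewrite -exprMn lerXn2r ?nnegrE ?enorm_ge0//.
      by rewrite mulr_ge0 ?ltW//; lra.
    move: y1; rewrite ltr_norml => /andP[_ y1]; rewrite mulrDl mul1r.
    lra.
  by rewrite exprn_ege1.
have -> : \int[mu]_y (a * g y * (Kmod lambda M.+1 x y / (C * growth lambda M.+1 x))) =
    a / (C * growth lambda M.+1 x) * \int[mu]_y (g y * Kmod lambda M.+1 x y).
  rewrite -RintegralZl//; apply: eq_Rintegral => y _.
  by field; rewrite !gt_eqF.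
rewrite normrM ger0_norm; last by rewrite divr_ge0 ?(ltW a0) ?(ltW Cw).
apply: (@le_trans _ _ (a / (C * growth lambda M.+1 x) *
  (c1 * (growth lambda M.+1 x * enorm x ^+ M) / 2))).
  rewrite le_eqVlt /a; apply/orP; left; apply/eqP.
  by field; rewrite !gt_eqF.
by rewrite ler_pM2l// divr_gt0.
Qed.

End Main.

Section Sharpness.
Context {R : realType} {m : nat}.
Local Notation V := 'rV[R]_m.

Lemma locally_finite_sum_continuous (s : nat -> R) (g : nat -> V -> R) :
  (forall l, continuous (g l)) -> (forall l y, enorm y < l.+1%:R -> g l y = 0) ->
  continuous (fun y => \sum_(l < Num.trunc (enorm y)) s l * g l y).
Proof.
move=> cg g0 y; pose N0 := Num.trunc (enorm y + 1).
have E z : enorm z < enorm y + 1 ->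
    \sum_(l < N0) s l * g l z = \sum_(l < Num.trunc (enorm z)) s l * g l z.
  move=> zy; rewrite -!(big_mkord xpredT (fun l => s l * g l z)).
  rewrite (@big_cat_nat _ _ _ (Num.trunc (enorm z)) 0 N0)//=; last first.
    by apply: le_truncn; exact: ltW.
  rewrite [X in _ + X = _]big_nat_cond [X in _ + X = _]big1 ?addr0// => l.
  rewrite andbT => /andP[zl _]; rewrite g0 ?mulr0//.
  by apply: lt_le_trans (truncnS_gt _) _; rewrite ler_nat ltnS.
rewrite /continuous_at -E ?ltrDl//.
have cF : continuous (fun z : V => \sum_(l < N0) s l * g l z).
  apply: continuous_sum_fun => l; apply: continuous_mul_fun => //.
  exact: cst_continuous.
have near_y : \forall z \near y, \sum_(l < N0) s l * g l z =
    \sum_(l < Num.trunc (enorm z)) s l * g l z.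
  have : \forall z \near y, enorm z < enorm y + 1.
    by have /cvgr_lt := @continuous_enorm R m y; apply; rewrite ltrDl.
  by apply: filterS => z; exact: E.
exact: cvg_trans (near_eq_cvg near_y) (cF y).
Qed.

Variable lambda : R.
Hypothesis l0 : 0 < lambda.
Variable M : nat.

Lemma Fmod_sharp (psi : 'rV[R]_m.+1 -> R) (X : nat -> 'rV[R]_m.+1) : (0 < m)%N ->
  (forall x, half_space x -> 0 < psi x) -> little_o psi (growth lambda M.+1) ->
  (forall i, half_space (X i)) -> enorm (X i) @[i --> \oo] --> +oo ->
  exists f : V -> R, [/\ continuous f, moment_finite M.+1 f &
     ~ (Fmod lambda M.+1 f (X i) / psi (X i) @[i --> \oo] --> 0)].
Proof.
move=> m0 psi0 psio hX Xoo.
have [C [c [C0 c0 HB]]] := normalized_bump l0 M m0.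
pose q := c / (c + 2).
have q0 : 0 < q by rewrite divr_gt0// addr_gt0.
(* Along the subsequence sg the quotient psi/growth decays as fast as the
   coefficients of the humps. *)
have /choice[sg Hsg] : forall j, exists i, [/\ (j <= i)%N, j.+2%:R <= enorm (X i) &
    psi (X i) <= growth lambda M.+1 (X i) * q ^+ j].
  move=> j.
  have qj : (0 < (q ^+ j)%:E :> \bar R)%E by rewrite lte_fin exprn_gt0.
  have H1 : \forall i \near \oo, (ereal_sup [set (`|psi x| / growth lambda M.+1 x)%:E |
      x in [set x | half_space x /\ enorm x = enorm (X i)]] < (q ^+ j)%:E)%E.
    have /psio : nbhs (0%:E : \bar R) [set z : \bar R | (z < (q ^+ j)%:E)%E].
      by apply: open_nbhs_nbhs; split => //; exact: open_ereal_lt_ereal.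
    exact: Xoo.
  have H2 : \forall i \near \oo, j.+2%:R <= enorm (X i) by move/cvgryPge: Xoo; apply.
  have : \forall i \near \oo, (j <= i)%N by exact: nbhs_infty_ge.
  move=> H3; have [i [? [? H]]] := filter_ex (filterI H3 (filterI H2 H1)).
  exists i; split => //.
  have w0 := growth_gt0 lambda M (hX i).
  rewrite mulrC -ler_pdivrMr//.
  apply: ltW; rewrite -lte_fin; apply: le_lt_trans H.
  apply: ereal_sup_ubound => /=; exists (X i) => //.
  by rewrite ger0_norm// ltW// psi0.
pose k j (y : V) := Kmod lambda M.+1 (X (sg j)) y / (C * growth lambda M.+1 (X (sg j))).
have sg1 j : 1 <= enorm (X (sg j)).
  by have [_ + _] := Hsg j; apply: le_trans; rewrite ler1n.
have kw j y : `|k j y| <= enorm y ^+ M + 1.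
  by have [+ _] := HB _ (hX (sg j)) (sg1 j); exact.
have /choice[g Hg] : forall j, exists g : V -> R, [/\ continuous g, forall y, 0 <= g y,
      forall y, enorm y <= enorm (X (sg j)) - 1 -> g y = 0,
      (\int[@completed_lebesgue_rV R m]_y (g y * (enorm y ^+ M + 1))%:E <= 1)%E &
      c <= `|\int[@completed_lebesgue_rV R m]_y (g y * k j y)|].
  by move=> j; have [_ ] := HB _ (hX (sg j)) (sg1 j).
have ck j : continuous (k j).
  apply: continuous_mul_fun; last exact: cst_continuous.
  exact: continuous_Kmod.
(* The l-th hump lives outside the ball of radius l + 1: hence j.+2 above. *)
have gz l y : enorm y < l.+1%:R -> g l y = 0.
  move=> yl; have [_ _ + _ _] := Hg l; apply.
  have [_ + _] := Hsg l; rewrite -natr1; move: yl; lra.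
have mk j : lebesgue_measurable_fun (k j) by exact: continuous_lebesgue_measurable.
have mg j : lebesgue_measurable_fun (g j).
  by apply: continuous_lebesgue_measurable; have [] := Hg j.
have mw : lebesgue_measurable_fun (fun y : V => enorm y ^+ M + 1).
  exact/continuous_lebesgue_measurable/continuous_weight.
have g0 j y : 0 <= g j y by have [_ + _ _ _] := Hg j.
have gw j : (\int[@completed_lebesgue_rV R m]_y (g j y * (enorm y ^+ M + 1))%:E <= 1)%E.
  by have [] := Hg j.
have gk j : c <= `|\int[@completed_lebesgue_rV R m]_y (g j y * k j y)| by have [] := Hg j.
have gN (y : V) l : (Num.trunc (enorm y) <= l)%N -> g l y = 0.
  by rewrite truncn_le_nat => /gz.
have [s [sfin sk]] := @gliding_hump _ _ _ (@completed_lebesgue_rV R m) k g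
  (fun y => enorm y ^+ M + 1) c (fun y => Num.trunc (enorm y)) c0 mk mg mw g0 kw gw gk gN.
pose f (y : V) := \sum_(l < Num.trunc (enorm y)) s l * g l y.
have cf : continuous f.
  by apply: locally_finite_sum_continuous => // l; have [] := Hg l.
have mf : lebesgue_measurable_fun f by exact: continuous_lebesgue_measurable.
exists f; split => // F0.
have Cc : 0 < C * (c / 2) by rewrite mulr_gt0// divr_gt0.
have /cvgr0Pnorm_lt /(_ _ Cc) [j _ /(_ (sg j))] := F0.
have [jsg _ psij] := Hsg j.
move=> /(_ jsg); apply/negP; rewrite -leNgt.
have w0 := growth_gt0 lambda M (hX (sg j)).
have Cw : 0 < C * growth lambda M.+1 (X (sg j)) by rewrite mulr_gt0.
have p0 := psi0 _ (hX (sg j)).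
have ifk : (@completed_lebesgue_rV R m).-integrable setT (EFin \o (fun y => f y * k j y)).
  have [a fa] : exists a, (\int[@completed_lebesgue_rV R m]_y
      (`|f y| * (enorm y ^+ M + 1))%:E <= a%:E)%E.
    exists (fine (\int[@completed_lebesgue_rV R m]_y (`|f y| * (enorm y ^+ M + 1))%:E)%E).
    rewrite fineK// ge0_fin_numE//; apply: integral_ge0 => y _.
    by rewrite lee_fin mulr_ge0// addr_ge0// exprn_ge0// enorm_ge0.
  exact: (@weighted_pairing _ _ _ (@completed_lebesgue_rV R m) _ _ _ _ mw (mk j) mf (kw j) fa).1.
have -> : Fmod lambda M.+1 f (X (sg j)) = C * growth lambda M.+1 (X (sg j)) *
    \int[@completed_lebesgue_rV R m]_y (f y * k j y).
  rewrite -RintegralZl//; apply: eq_Rintegral => y _; rewrite /k.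
  by field; rewrite !gt_eqF.
rewrite normrM normfV (gtr0_norm p0) normrM (gtr0_norm Cw) ler_pdivlMr//.
apply: (@le_trans _ _ (C * (c / 2) * (growth lambda M.+1 (X (sg j)) * q ^+ j))).
  by rewrite ler_pM2l.
by rewrite mulrACA ler_pM2l.
Qed.

End Sharpness.

Theorem theorem4p1 (R : realType) (n : nat) (lambda : R) (M : nat)
    (hn : (2 <= n)%N) (hlambda : 0 < lambda) (hM : (1 <= M)%N) :
  (forall f : 'rV[R]_n.-1 -> R,
     lebesgue_measurable_fun f -> moment_finite M f ->
     little_o (Fmod lambda M f) (growth lambda M)) /\
  (forall psi : 'rV[R]_n.-1.+1 -> R,
     (forall x, half_space x -> 0 < psi x) ->
     little_o psi (growth lambda M) ->
     forall X : nat -> 'rV[R]_n.-1.+1,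
       (forall i, half_space (X i)) ->
       enorm (X i) @[i --> \oo] --> +oo ->
       exists f : 'rV[R]_n.-1 -> R,
         [/\ continuous f, moment_finite M f &
             ~ (Fmod lambda M f (X i) / psi (X i) @[i --> \oo] --> 0)]).
Proof.
have m0 : (0 < n.-1)%N by rewrite -ltnS prednK// ltnW.
case: M hM => // M _; split => [f|psi psi0 psio X hX Xoo].
  exact: Fmod_little_o.
exact: Fmod_sharp.
Qed.
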